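(* Let $d\ge 2$ and let $\mathcal L$ be a lamination in the base of a pullback tree (for $\sigma_d$). Then every leaf of $\mathcal L$ having a periodic endpoint has both endpoints periodic, of the same period. Consequently every lamination in the base of the pullback tree is proper and sibling $d$-invariant.
   Context: Circle and laminations. $\mathbb S=\mathbb R/\mathbb Z$ is the boundary of the closed unit disk, $\sigma_d(\theta)=d\theta\bmod1$. A lamination is a closed set of chords of the disk that do not cross except possibly at endpoints, additionally including every point of the circle (degenerate leaves). A leaf is a nondegenerate chord in the lamination; $\sigma_d(\overline{ab})=\overline{\sigma_d(a)\sigma_d(b)}$. A leaf is critical if its two endpoints have the same image. The equivalence relation of a lamination is the minimal one in which the endpoints of each leaf are equivalent. A leaf or class is periodic if some iterate $\sigma_d^k$, $k\ge1$, maps it to itself. FDL. A nonempty lamination $\mathcal L$ is a Finite Dynamical Lamination (FDL) in degree $d$ if: (1) $\mathcal L$ has finitely many leaves; (2) for each leaf $\overline{ab}$, $\sigma_d(a)\ne\sigma_d(b)$; (3) for each leaf $\ell\in\mathcal L$, $\sigma_d(\ell)\in\mathcal L$; (4) there is a whole number $n\ge0$ such that each non-periodic leaf $\ell$ has a preimage in $\mathcal L$ iff $\sigma_d^{n-1}(\ell)$ is periodic, and each periodic leaf has a non-periodic preimage in $\mathcal L$ iff $n>0$; (5) for each non-periodic leaf $\ell\in\mathcal L$ there are $d$ disjoint leaves $\ell_1=\ell,\dots,\ell_d$ in $\mathcal L$ with $\sigma_d(\ell_i)=\sigma_d(\ell)$ for all $i$; (6) a leaf $\ell$ is in $\mathcal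 L$ iff it is on the boundary of the convex hull of an equivalence class of $\mathcal L$; (7) the leaves of any periodic equivalence class of $\mathcal L$ map as a covering with positive orientation. Pullback tree. Given a set $P$ of periodic leaves constituting an FDL, the pullback tree of $P$ is the graph whose vertices are all FDL having exactly $P$ as set of periodic leaves, two different FDL being joined by an edge iff one is the image of the other (the image of an FDL being the lamination whose leaves are the $\sigma_d$-images of its leaves); its root is the FDL that is its own image. A sequence to the end of the pullback tree is an infinite sequence of FDL in the tree starting at the root, such that each FDL is the image of the next one and is different from it. Limits of such sequences (with respect to the Hausdorff distance on laminations, viewed as sets of leaves and degenerate leaves, where the distance between two chords is the sum of the circle distances between corresponding endpoints, minimized over the matching of endpoints) are the ends of the pullback tree; the set of ends is the base of the pullback tree. Invariance and properness. $\mathcal L$ is sibling $d$-invariant if: for each $\ell\in\mathcal L$, $\sigma_d(\ell)\in\mathcal L$ or $\sigma_d(\ell)$ is a point; each $\ell\in\mathcal L$ equals $\sigma_d(\ell')$ for some $\ell'\in\mathcal L$; and for each $\ell\in\mathcal L$ whose image is not a point there are $d$ pairwise disjoint leaves $\ell_1=\ell,\dots,\ell_d\in\mathcal L$ with $\sigma_d(\ell_i)=\sigma_d(\ell)$. Two leaves with a common endpoint $v$ and the same image which is a leaf form a critical wedge with vertex $v$. A lamination is proper if it contains no critical leaf with a periodic endpoint and no critical wedge with a periodic vertex. *)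

(* Defs.v *)
From Stdlib Require Import Relations.
From HB Require Import structures.
From mathcomp Require Import all_boot all_order all_algebra.
From mathcomp Require Import all_classical all_reals all_analysis.

Set Implicit Arguments.
Unset Strict Implicit.
Unset Printing Implicit Defensive.

Import Order.TTheory GRing.Theory Num.Theory.
Import numFieldNormedType.Exports.

Local Open Scope classical_set_scope.
Local Open Scope ring_scope.

(* A point of R/Z is its representative in [0, 1[, so that equality on
   [circle R] is Leibniz equality. *)
Record circle (R : realType) := Circle {
  angle : R;
  _ : 0 <= angle < 1 }.

HB.instance Definition _ (R : realType) := [isSub for @angle R].
HB.instance Definition _ (R : realType) := [Choice of circle R by <:].

Definition frac (R : realType) (x : R) : R := x - (Num.floor x)%:~R.

Lemma frac_bound (R : realType) (x : R) : 0 <= frac x < 1.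
Proof.
by rewrite /frac subr_ge0 ltrBlDl -[X in _ + X](mulr1z 1) -intrD floor_itv.
Qed.

Definition proj (R : realType) (x : R) : circle R := Circle (frac_bound x).

Definition sigma (R : realType) (d : nat) (a : circle R) : circle R :=
  proj (d%:R * angle a).

Definition circle_dist (R : realType) (a b : circle R) : R :=
  Num.min `|angle a - angle b| (1 - `|angle a - angle b|).

(* The length of the counterclockwise arc from a to b. *)
Definition turn (R : realType) (a b : circle R) : R := frac (angle b - angle a).

(* The open counterclockwise arc from a to b. *)
Definition arc (R : realType) (a b : circle R) : set (circle R) :=
  [set x | 0 < turn a x < turn a b].

Definition periodic_point (R : realType) (d : nat) (a : circle R) :=
  exists2 k, (0 < k)%N & iter k (sigma d) a = a.

Definition has_period (R : realType) (d : nat) (a : circle R) (k : nat) :=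
  [/\ (0 < k)%N, iter k (sigma d) a = a &
      forall j, (0 < j < k)%N -> iter j (sigma d) a <> a].

(* A chord is an unordered pair of endpoints, stored in increasing order of
   angle; it is degenerate when the endpoints coincide. *)
Record chord (R : realType) := Chord {
  chord_ends : circle R * circle R;
  _ : angle chord_ends.1 <= angle chord_ends.2 }.

HB.instance Definition _ (R : realType) := [isSub for @chord_ends R].
HB.instance Definition _ (R : realType) := [Choice of chord R by <:].

Definition sort_ends (R : realType) (a b : circle R) : circle R * circle R :=
  if angle a <= angle b then (a, b) else (b, a).

Lemma sort_ends_le (R : realType) (a b : circle R) :
  angle (sort_ends a b).1 <= angle (sort_ends a b).2.
Proof. by rewrite /sort_ends; case: (leP (angle a)) => //= /ltW. Qed.

Definition mkchord (R : realType) (a b : circle R) : chord R :=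
  Chord (sort_ends_le a b).

Lemma mkchordC (R : realType) (a b : circle R) : mkchord a b = mkchord b a.
Proof.
apply: val_inj => /=; rewrite /sort_ends.
case: (ltgtP (angle a) (angle b)) => // ab.
by have -> : a = b by exact: val_inj.
Qed.

Definition end1 (R : realType) (l : chord R) : circle R := (chord_ends l).1.
Definition end2 (R : realType) (l : chord R) : circle R := (chord_ends l).2.

Lemma mkchord_ends (R : realType) (l : chord R) : mkchord (end1 l) (end2 l) = l.
Proof. by apply: val_inj; case: l => -[a b] /= ab; rewrite /sort_ends ab. Qed.

Definition is_end (R : realType) (l : chord R) (v : circle R) :=
  v = end1 l \/ v = end2 l.

Definition degenerate (R : realType) (l : chord R) := end1 l = end2 l.

Definition chord_map (R : realType) (d : nat) (l : chord R) : chord R :=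
  mkchord (sigma d (end1 l)) (sigma d (end2 l)).

Definition periodic_chord (R : realType) (d : nat) (l : chord R) :=
  exists2 k, (0 < k)%N & iter k (chord_map d) l = l.

Definition chord_dist (R : realType) (l m : chord R) : R :=
  Num.min (circle_dist (end1 l) (end1 m) + circle_dist (end2 l) (end2 m))
          (circle_dist (end1 l) (end2 m) + circle_dist (end2 l) (end1 m)).

Definition hausdorff_dist (R : realType) (A B : set (chord R)) : R :=
  Num.max (sup [set inf [set chord_dist l m | m in B] | l in A])
          (sup [set inf [set chord_dist l m | l in A] | m in B]).

(* The closed unit disk lies in the plane R^o * R^o, where R^o is R as a vector
   space over itself. *)
Definition circle_pt (R : realType) (a : circle R) : R^o * R^o :=
  (cos (2 * pi * angle a), sin (2 * pi * angle a)).

Definition segment (R : realType) (l : chord R) : set (R^o * R^o) :=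
  [set (1 - t) *: circle_pt (end1 l) + t *: circle_pt (end2 l)
     | t in [set t : R | 0 <= t <= 1]].

Definition convex_hull (R : realType) (X : set (R^o * R^o)) : set (R^o * R^o) :=
  smallest (@convex_set R (R^o * R^o)%type) X.

Definition boundary (R : realType) (X : set (R^o * R^o)) : set (R^o * R^o) :=
  closure X `\` interior X.

Definition disjoint_chords (R : realType) (l m : chord R) :=
  segment l `&` segment m = set0.

(* A chord meets the circle only in its endpoints, so a common point of two
   segments that is an endpoint of l is an endpoint of m too. *)
Definition noncrossing (R : realType) (l m : chord R) :=
  forall x, segment l x -> segment m x -> exists2 v, is_end l v & x = circle_pt v.

Definition closed_chords (R : realType) (L : set (chord R)) :=
  forall l, (forall e : R, 0 < e -> exists2 m, L m & chord_dist l m < e) -> L l.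

Definition lamination (R : realType) (L : set (chord R)) :=
  [/\ closed_chords L,
      forall l m, L l -> L m -> l <> m -> noncrossing l m &
      forall l, degenerate l -> L l].

Definition leaf (R : realType) (L : set (chord R)) (l : chord R) :=
  L l /\ ~ degenerate l.

Definition with_points (R : realType) (A : set (chord R)) : set (chord R) :=
  A `|` [set l | degenerate l].

Definition lam_equiv (R : realType) (L : set (chord R)) : relation (circle R) :=
  clos_refl_sym_trans _ (fun a b => leaf L (mkchord a b)).

Definition lam_class (R : realType) (L : set (chord R)) (C : set (circle R)) :=
  exists a, C = [set b | lam_equiv L a b].

Definition periodic_class (R : realType) (d : nat) (C : set (circle R)) :=
  exists2 k, (0 < k)%N & iter k (sigma d) @` C = C.

(* (a, b) is an edge of the polygon with vertex set C, in counterclockwise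
   order. *)
Definition oriented_edge (R : realType) (C : set (circle R)) (a b : circle R) :=
  [/\ C a, C b, a <> b & C `&` arc a b = set0].

(* In a finite set with at least two points exactly one edge leaves, and
   exactly one enters, each vertex.  Hence a map sending oriented edges of C to
   oriented edges of its image is an orientation-preserving covering of the
   polygon spanned by the image (with one edge of either orientation for each
   side of a two-gon). *)
Definition positive_covering (R : realType) (d : nat) (C : set (circle R)) :=
  forall a b, oriented_edge C a b ->
    oriented_edge (sigma d @` C) (sigma d a) (sigma d b).

Definition has_siblings (R : realType) (d : nat) (L : set (chord R)) (l : chord R) :=
  exists f : 'I_d -> chord R,
    [/\ exists i, f i = l,
        forall i, leaf L (f i) /\ chord_map d (f i) = chord_map d l &
        forall i j, i <> j -> disjoint_chords (f i) (f j)].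

Record FDL (R : realType) (d : nat) (L : set (chord R)) : Prop := {
  fdl_lamination : lamination L;
  (* every lamination contains the points of the circle, so a nonempty one is
     one that has a leaf *)
  fdl_nonempty : exists l, leaf L l;
  fdl_finite : finite_set [set l | leaf L l];
  fdl_noncritical : forall a b, leaf L (mkchord a b) -> sigma d a <> sigma d b;
  fdl_forward : forall l, leaf L l -> L (chord_map d l);
  (* For n = 0, [iter n.-1 (chord_map d) l] is l.  As "sigma_d^(-1)(l) is
     periodic", "l is periodic" is then false for a non-periodic l. *)
  fdl_depth : exists n : nat,
    (forall l, leaf L l -> ~ periodic_chord d l ->
       ((exists2 m, leaf L m & chord_map d m = l) <->
        periodic_chord d (iter n.-1 (chord_map d) l))) /\
    (forall l, leaf L l -> periodic_chord d l ->
       ((exists m, [/\ leaf L m, ~ periodic_chord d m & chord_map d m = l]) <->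
        (0 < n)%N));
  fdl_siblings : forall l, leaf L l -> ~ periodic_chord d l -> has_siblings d L l;
  fdl_hull : forall l, ~ degenerate l ->
    (L l <-> exists2 C, lam_class L C &
               segment l `<=` boundary (convex_hull (@circle_pt R @` C)));
  fdl_covering : forall C, lam_class L C -> periodic_class d C ->
    positive_covering d C }.

Definition constitutes_FDL (R : realType) (d : nat) (P : set (chord R)) :=
  (forall l, P l -> ~ degenerate l /\ periodic_chord d l) /\
  FDL d (with_points P).

Definition pullback_tree (R : realType) (d : nat) (P : set (chord R))
    : set (set (chord R)) :=
  [set L | FDL d L /\ [set l | leaf L l /\ periodic_chord d l] = P].

Definition lam_image (R : realType) (d : nat) (L : set (chord R))
    : set (chord R) :=
  with_points (chord_map d @` [set l | leaf L l]).

Definition sequence_to_end (R : realType) (d : nat) (P : set (chord R))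
    (Ls : nat -> set (chord R)) :=
  [/\ forall n, pullback_tree d P (Ls n),
      lam_image d (Ls 0%N) = Ls 0%N &
      forall n, lam_image d (Ls n.+1) = Ls n /\ Ls n.+1 <> Ls n].

Definition base (R : realType) (d : nat) (P : set (chord R))
    : set (set (chord R)) :=
  [set L | lamination L /\
     exists2 Ls, sequence_to_end d P Ls &
       (hausdorff_dist (Ls n) L @[n --> \oo] --> (0 : R))].

Definition sibling_invariant (R : realType) (d : nat) (L : set (chord R)) :=
  [/\ forall l, L l -> L (chord_map d l) \/ degenerate (chord_map d l),
      forall l, L l -> exists2 m, L m & chord_map d m = l &
      forall l, L l -> ~ degenerate (chord_map d l) -> has_siblings d L l].

Definition critical_chord (R : realType) (d : nat) (l : chord R) :=
  sigma d (end1 l) = sigma d (end2 l).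

Definition critical_wedge (R : realType) (d : nat) (L : set (chord R))
    (v : circle R) (l m : chord R) :=
  [/\ leaf L l /\ leaf L m, l <> m, is_end l v /\ is_end m v,
      chord_map d l = chord_map d m & leaf L (chord_map d l)].

Definition proper_lamination (R : realType) (d : nat) (L : set (chord R)) :=
  (forall l v, leaf L l -> critical_chord d l -> is_end l v ->
     ~ periodic_point d v) /\
  (forall v l m, critical_wedge d L v l m -> ~ periodic_point d v).

(* Main.v *)
Require Import Defs.
From mathcomp Require Import all_boot all_order all_algebra.
From mathcomp Require Import all_classical all_reals all_analysis.
From mathcomp Require Import ring lra zify.
From Stdlib Require Import Relations.

(** Let Ls be a sequence to the end of a pullback tree with limit L.  Images of
leaves are leaves, so the sequence is increasing, and L is the closure of the
set U of all leaves of the Ls n.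

In one FDL every leaf is a side of the polygon spanned by its equivalence
class, hence at most two leaves meet at a vertex ([FDL_vertex]).  Suppose that
a leaf ab of Ls n had a periodic and b not.  Its siblings in later FDL allow one
to pull it back along the periodic orbit of a, so that after one and two turns
two further leaves at a appear; three leaves at a are too many.  Thus b is
periodic ([seq_periodic_end]).  The class of a then consists of periodic points
only, and an iterate of sigma fixing a maps this polygon to itself with positive
orientation; it sends the side leaving a to a side leaving a, so it fixes b
([FDL_fix]).

A leaf ab of L with sigma^k(a) = a is a limit of chords m of U.  If m ends at a,
the previous case applies to m, and it passes to b since the fixed points of
sigma^k are isolated.  Otherwise one end of m lies close to a on one side, and
sigma^k pushes it away from a on that side.  If sigma^k(b) is not b, then
comparing the cyclic positions of a, b and sigma^k(b) shows that two of the
chords ab, m, sigma^k(ab) and sigma^k(m) of L cross, except when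
sigma^k(b) = a and m ends at b; in that case sigma^k(m) is a chord of U that
ends at a, to which the previous case applies again ([no_leaf_on_side]).
So b is fixed by every iterate of sigma that fixes a, and conversely
([limit_fix]).

Properness follows because sigma is injective on periodic points.  For sibling
invariance, images, preimages and sibling families of chords of U pass to the
limit: the preimages of a chord are parametrised by finitely many indices, so
for a chord of L one choice of indices works at every precision.  That a
periodic leaf of U has siblings at all comes from a non-periodic leaf with the
same image ([seq_siblings]). *)

Set Implicit Arguments.
Unset Strict Implicit.
Unset Printing Implicit Defensive.

Import Order.TTheory GRing.Theory Num.Theory.
Import numFieldNormedType.Exports.
Import Defs.

Local Open Scope classical_set_scope.
Local Open Scope ring_scope.

(** * Arithmetic of angles, chords and distances *)

Section CircleArithmetic.
Context {R : realType}.
Implicit Types (a b c v : circle R) (x y z t u : R) (l m : chord R).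

Lemma angle_itv a : 0 <= angle a < 1.
Proof. by case: a. Qed.

Lemma frac_id x : 0 <= x < 1 -> frac x = x.
Proof.
by move=> x01; rewrite /frac (@floor_def _ x 0) ?subr0// add0r.
Qed.

Lemma fracDz x (n : int) : frac (x + n%:~R) = frac x.
Proof. by rewrite /frac floorDrz ?intr_int// intrKfloor intrD; ring. Qed.

Lemma angleK a : proj (angle a) = a.
Proof. by apply: val_inj => /=; rewrite frac_id// angle_itv. Qed.

Lemma projDz x (n : int) : proj (x + n%:~R) = proj x.
Proof. by apply: val_inj; rewrite /= fracDz. Qed.

Lemma projD1 x : proj (x + 1) = proj x.
Proof. exact: (projDz x 1). Qed.

Lemma projB1 x : proj (x - 1) = proj x.
Proof. exact: (projDz x (-1)). Qed.

Lemma angle_projE x : exists n : int, angle (proj x) = x + n%:~R.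
Proof. by exists (- Num.floor x); rewrite intrN. Qed.

Lemma proj_eqP x y : proj x = proj y <-> exists n : int, y = x + n%:~R.
Proof.
split=> [/(congr1 (@angle R)) xy|[n ->]]; last by rewrite projDz.
have [m mE] := angle_projE x; have [n nE] := angle_projE y.
by exists (m - n); rewrite intrB; lra.
Qed.

Lemma proj_inj_lt1 x y : `|x - y| < 1 -> proj x = proj y -> x = y.
Proof.
move=> xy /proj_eqP[n yE]; suff n0 : n = 0 by rewrite yE n0 addr0.
move: xy; rewrite yE opprD addNKr normrN -intr_norm -[1]/(1%:~R) ltr_int.
by lia.
Qed.

Lemma sigma_proj d x : sigma d (proj x) = proj (d%:R * x).
Proof.
have [n nE] := angle_projE x; apply/esym/proj_eqP; exists (d%:Z * n).
by rewrite nE mulrDr intrM.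
Qed.

Lemma iter_sigma_proj d k x : iter k (sigma d) (proj x) = proj (d%:R ^+ k * x).
Proof.
elim: k => [|k IH]; first by rewrite mul1r.
by rewrite iterS IH sigma_proj mulrA -exprS.
Qed.

Lemma sigma_preimage d x a : (0 < d)%N -> sigma d a = proj x ->
  exists i : 'I_d, a = proj ((x + i%:R) / d%:R).
Proof.
move=> d0; have dR : 0 < d%:R :> R by rewrite ltr0n.
rewrite -(angleK a) sigma_proj => /esym/proj_eqP[n nE].
have nd : (0 <= n %% d)%Z by rewrite modz_ge0//; lia.
have nd2 : (`|(n %% d)%Z| < d)%N by rewrite -ltz_nat gez0_abs// ltz_pmod.
exists (Ordinal nd2); apply/esym/proj_eqP; exists (n %/ d)%Z => /=.
have -> : angle a = (x + n%:~R) / d%:R by rewrite -nE mulrC mulKf// gt_eqF.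
have -> : `|(n %% d)%Z|%N%:R = (n %% d)%Z%:~R :> R.
  by rewrite -[in RHS](gez0_abs nd).
rewrite [in LHS](divz_eq n d) intrD intrM.
by field; rewrite gt_eqF.
Qed.

Lemma preimage_inj d x (i j : 'I_d) :
  proj ((x + i%:R) / d%:R) = proj ((x + j%:R) / d%:R) -> i = j.
Proof.
case: d i j => [[]//|d] i j /proj_inj_lt1 ij; apply: val_inj => /=.
have dR : 0 < d.+1%:R :> R by rewrite ltr0n.
apply/eqP; rewrite -(eqr_nat R); apply/eqP.
suff /ij : `|(x + i%:R) / d.+1%:R - (x + j%:R) / d.+1%:R| < 1.
  by move/(mulIf (invr_neq0 (lt0r_neq0 dR)))/addrI.
rewrite -mulrBl normrM normfV (gtr0_norm dR) ltr_pdivrMr// mul1r.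
have := ltn_ord i; have := ltn_ord j; rewrite -!(ltr_nat R).
have : 0 <= i%:R :> R by []; have : 0 <= j%:R :> R by [].
by rewrite ltr_norml; lra.
Qed.

Lemma mkchord_inj a b c v :
  mkchord a b = mkchord c v -> (a = c /\ b = v) \/ (a = v /\ b = c).
Proof.
move/(congr1 (@chord_ends R)); rewrite /= /sort_ends.
by case: ifP; case: ifP => _ _ [-> ->]; auto.
Qed.

Lemma mkchord_injr a b c : mkchord a b = mkchord a c -> b = c.
Proof. by move/mkchord_inj => [[]|[-> ->]]. Qed.

Lemma end_mkchord a b :
  (end1 (mkchord a b) = a /\ end2 (mkchord a b) = b) \/
  (end1 (mkchord a b) = b /\ end2 (mkchord a b) = a).
Proof. by rewrite /end1 /end2 /= /sort_ends; case: ifP; [left|right]. Qed.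

Lemma chordP l : exists x y, l = mkchord (proj x) (proj y).
Proof. by exists (angle (end1 l)), (angle (end2 l)); rewrite !angleK mkchord_ends. Qed.

Lemma is_end_mk a b v : is_end (mkchord a b) v <-> v = a \/ v = b.
Proof. by rewrite /is_end; case: (end_mkchord a b) => -[-> ->]; tauto. Qed.

Lemma degenerate_mk a b : degenerate (mkchord a b) <-> a = b.
Proof. by rewrite /degenerate; case: (end_mkchord a b) => -[-> ->]; split. Qed.

Lemma chord_map_mk d a b :
  chord_map d (mkchord a b) = mkchord (sigma d a) (sigma d b).
Proof. by rewrite /chord_map; case: (end_mkchord a b) => -[-> ->]//; rewrite mkchordC. Qed.

Lemma iter_chord_map_mk d k a b : iter k (chord_map d) (mkchord a b) =
  mkchord (iter k (sigma d) a) (iter k (sigma d) b).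
Proof. by elim: k => //= k ->; rewrite chord_map_mk. Qed.

Lemma iter_mul_fix (T : Type) (f : T -> T) k n (x : T) :
  iter k f x = x -> iter (n * k) f x = x.
Proof. by move=> fx; elim: n => //= n IH; rewrite mulSn iterD IH. Qed.

Lemma periodic_chord_mk d a b :
  periodic_chord d (mkchord a b) -> periodic_point d a /\ periodic_point d b.
Proof.
move=> [k k0]; rewrite iter_chord_map_mk => /mkchord_inj[[ka kb]|[ka kb]].
  by split; exists k.
by split; exists (k + k)%N; rewrite ?addn_gt0 ?k0// iterD ?ka kb.
Qed.

Lemma periodic_point_iter d a j :
  periodic_point d a -> periodic_point d (iter j (sigma d) a).
Proof. by move=> [k k0 ka]; exists k => //; rewrite -iterD addnC iterD ka. Qed.

(** One step less than a common period of [a] and [b] undoes [sigma] at both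
points. *)
Lemma periodic_sigma_inj d a b : periodic_point d a -> periodic_point d b ->
  sigma d a = sigma d b -> a = b.
Proof.
move=> [k k0 ka] [m m0 mb] ab.
have km : (0 < k * m)%N by rewrite muln_gt0 k0.
rewrite -(iter_mul_fix k mb) -(iter_mul_fix m ka) (mulnC m).
by rewrite -(prednK km) !iterSr ab.
Qed.

Lemma periodic_chord_map d l : periodic_chord d l -> periodic_chord d (chord_map d l).
Proof. by move=> [k k0 kl]; exists k => //; rewrite -iterSr iterS kl. Qed.

Lemma circle_dist_le x t : circle_dist (proj x) (proj (x + t)) <= `|t|.
Proof.
rewrite /circle_dist; have [m mE] := angle_projE x.
have [n nE] := angle_projE (x + t).
have := angle_itv (proj x); have := angle_itv (proj (x + t)).
set s := angle (proj x) - _; have sE : s = - (t + (n - m)%:~R).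
  by rewrite /s mE nE intrB; ring.
move=> h1 h2; have s1 : `|s| < 1 by rewrite ltr_norml /s; lra.
have [nm|nm] := eqVneq (n - m) 0.
  by rewrite ge_min sE nm addr0 normrN lexx.
have /orP[nm1|nm1] : (n - m <= -1) || (1 <= n - m) by lia.
  have : (n - m)%:~R <= (-1)%:~R :> R by rewrite ler_int.
  rewrite ge_min; have := ler_norm s; have := ler_norm (- s).
  have := ler_norm t; have := ler_norm (- t).
  by rewrite !normrN [(-1)%:~R]mulrN1z; lra.
have : 1%:~R <= (n - m)%:~R :> R by rewrite ler_int.
rewrite ge_min; have := ler_norm s; have := ler_norm (- s).
have := ler_norm t; have := ler_norm (- t).
by rewrite !normrN mulr1z; lra.
Qed.

Lemma circle_distC a b : circle_dist a b = circle_dist b a.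
Proof. by rewrite /circle_dist distrC. Qed.

Lemma circle_dist_ge0 a b : 0 <= circle_dist a b.
Proof.
rewrite /circle_dist le_min normr_ge0 subr_ge0/=.
by have := angle_itv a; have := angle_itv b; rewrite ler_norml; lra.
Qed.

Lemma circle_dist_le1 a b : circle_dist a b <= 1.
Proof.
rewrite /circle_dist ge_min; apply/orP; left.
by have := angle_itv a; have := angle_itv b; rewrite ler_norml; lra.
Qed.

(** Closeness on the circle becomes a small real perturbation of a lift; all later
estimates are made on such perturbations. *)
Lemma circle_dist_lt x b e : circle_dist (proj x) b < e ->
  exists2 t, `|t| < e & b = proj (x + t).
Proof.
have [n nE] := angle_projE x; rewrite /circle_dist gt_min.
set s := _ - _ => se.
suff [t te [k bE]] : exists2 t, `|t| < e & exists k : int, angle b = x + t + k%:~R.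
  by exists t => //; rewrite -(projDz _ k) -bE angleK.
case: (orP se) => {}se.
  by exists (- s); rewrite ?normrN//; exists n; rewrite /s nE; ring.
have s1 : -1 < s < 1.
  by rewrite /s; have := angle_itv (proj x); have := angle_itv b; lra.
move: se; case: (ltP 0 s) => [s0|s0] se.
  rewrite gtr0_norm// in se; exists (1 - s); last first.
    by exists (n - 1); rewrite intrB /s nE; ring.
  by rewrite ger0_norm//; lra.
rewrite ler0_norm// in se; exists (- 1 - s); last first.
  by exists (n + 1); rewrite intrD /s nE; ring.
by rewrite ler0_norm; lra.
Qed.

Lemma chord_dist_ge0 l m : 0 <= chord_dist l m.
Proof. by rewrite /chord_dist le_min !addr_ge0 ?circle_dist_ge0. Qed.

Lemma chord_dist_le2 l m : chord_dist l m <= 2.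
Proof.
rewrite /chord_dist ge_min; apply/orP; left.
by rewrite -[2]/(1 + 1) lerD ?circle_dist_le1.
Qed.

Lemma chord_distC l m : chord_dist l m = chord_dist m l.
Proof.
rewrite /chord_dist (circle_distC (end1 l)) (circle_distC (end2 l)).
by congr Num.min; rewrite addrC; congr (_ + _); rewrite circle_distC.
Qed.

Lemma chord_dist_mk a b c v :
  chord_dist (mkchord a b) (mkchord c v) =
  Num.min (circle_dist a c + circle_dist b v) (circle_dist a v + circle_dist b c).
Proof.
rewrite /chord_dist; case: (end_mkchord a b) => -[-> ->];
  case: (end_mkchord c v) => -[-> ->]//; rewrite minC //.
- by rewrite (addrC (circle_dist b c)) (addrC (circle_dist b v)) minC.
- by rewrite minC (addrC (circle_dist b c)) (addrC (circle_dist b v)) minC.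
Qed.

Lemma chord_dist_le x y t u :
  chord_dist (mkchord (proj x) (proj y)) (mkchord (proj (x + t)) (proj (y + u)))
    <= `|t| + `|u|.
Proof. by rewrite chord_dist_mk ge_min lerD// circle_dist_le. Qed.

Lemma chord_dist_lt x y l e : chord_dist (mkchord (proj x) (proj y)) l < e ->
  exists t u, [/\ `|t| < e, `|u| < e & l = mkchord (proj (x + t)) (proj (y + u))].
Proof.
rewrite -(mkchord_ends l) chord_dist_mk gt_min.
have d0 := circle_dist_ge0; move=> /orP[] h.
  have [|t te tE] := @circle_dist_lt x (end1 l) e.
    by apply: le_lt_trans h; rewrite lerDl.
  have [|u ue uE] := @circle_dist_lt y (end2 l) e.
    by apply: le_lt_trans h; rewrite lerDr.
  by exists t, u; rewrite -tE -uE.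
have [|t te tE] := @circle_dist_lt x (end2 l) e.
  by apply: le_lt_trans h; rewrite lerDl.
have [|u ue uE] := @circle_dist_lt y (end1 l) e.
  by apply: le_lt_trans h; rewrite lerDr.
by exists t, u; rewrite -tE -uE mkchordC.
Qed.

End CircleArithmetic.

(** * Crossing chords and convex hulls in the plane *)

Section PlaneGeometry.
Context {R : realType}.
Local Notation plane := (R^o * R^o)%type.
Implicit Types (a b c v : circle R) (x y z w : R) (l m : chord R).
Implicit Types (p q r s : plane) (X : set plane).

Definition affine (al be ga : R) (p : plane) : R := al * p.1 + be * p.2 + ga.

(** Twice the signed area of the triangle [p q r], positive when it is
counterclockwise.  Written as an affine form in [r], so that half-planes are
open, closed or convex by general facts on affine forms. *)
Definition orient (p q r : plane) : R :=
  affine (p.2 - q.2) (q.1 - p.1) (p.1 * q.2 - p.2 * q.1) r.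

Lemma affine_continuous al be ga : continuous (affine al be ga : plane -> R^o).
Proof.
move=> p; apply: cvgD; last exact: cvg_cst.
by apply: cvgD; apply: cvgM; [exact: cvg_cst|exact: cvg_fst|exact: cvg_cst|exact: cvg_snd].
Qed.

Lemma closed_affine_ge0 al be ga : closed [set p : plane | 0 <= affine al be ga p].
Proof.
have -> : [set p : plane | 0 <= affine al be ga p] =
  (affine al be ga : plane -> R^o) @^-1` [set x | 0 <= x] by [].
apply: closed_comp; last exact: closed_ge.
by move=> p _; exact: affine_continuous.
Qed.

Lemma open_affine_gt0 al be ga : open [set p : plane | 0 < affine al be ga p].
Proof.
have -> : [set p : plane | 0 < affine al be ga p] =
  (affine al be ga : plane -> R^o) @^-1` [set x | 0 < x] by [].
apply: open_comp; last exact: open_gt.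
by move=> p _; exact: affine_continuous.
Qed.

Lemma convex_affine_ge0 al be ga :
  @convex_set R plane [set p : plane | 0 <= affine al be ga p].
Proof.
move=> p q k; rewrite !inE /affine /= => p0 q0.
have k0 : 0 <= k%:num :> R by [].
have k1 : 0 <= 1 - k%:num :> R by rewrite subr_ge0.
rewrite /GRing.scale /= /unstable.onem.
have := mulr_ge0 k0 p0; have := mulr_ge0 k1 q0; lra.
Qed.

Lemma convex_comb (A : set plane) p q (t : R) : @convex_set R plane A ->
  A p -> A q -> 0 <= t <= 1 -> A (t *: p + (1 - t) *: q).
Proof.
move=> cA Ap Aq /andP[t0 t1].
by have := cA p q (Itv01 t0 t1); rewrite !inE; exact.
Qed.

(** The three signed areas cut out by [s] are its barycentric coordinates, up to
the factor [orient p q r]. *)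
Lemma triangle_sub_convex_hull X p q r s : X p -> X q -> X r ->
  0 < orient p q r ->
  0 <= orient q r s -> 0 <= orient r p s -> 0 <= orient p q s ->
  convex_hull X s.
Proof.
move=> Xp Xq Xr pqr0 al0 be0 ga0 A [cA XA].
have pqrE : orient q r s + orient r p s + orient p q s = orient p q r.
  by rewrite /orient /affine /=; ring.
have [Ap Aq Ar] : [/\ A p, A q & A r] by split; exact: XA.
(* The iterated convex combination below divides by the weight of q and r. *)
have [be_ga0|be_ga_neq0] := eqVneq (orient r p s + orient p q s) 0.
  suff -> : s = p by [].
  have e1 : orient r p s = 0 by lra.
  have e2 : orient p q s = 0 by lra.
  have e3 : (s.1 - p.1) * orient p q r = 0.
    have -> : (s.1 - p.1) * orient p q r =
      (q.1 - p.1) * orient r p s + (r.1 - p.1) * orient p q s.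
      by rewrite /orient /affine /=; ring.
    by rewrite e1 e2 !mulr0 addr0.
  have e4 : (s.2 - p.2) * orient p q r = 0.
    have -> : (s.2 - p.2) * orient p q r =
      (q.2 - p.2) * orient r p s + (r.2 - p.2) * orient p q s.
      by rewrite /orient /affine /=; ring.
    by rewrite e1 e2 !mulr0 addr0.
  move/eqP: e3; rewrite mulf_eq0 (gt_eqF pqr0) orbF subr_eq0 => /eqP e3.
  move/eqP: e4; rewrite mulf_eq0 (gt_eqF pqr0) orbF subr_eq0 => /eqP e4.
  by rewrite [s]surjective_pairing e3 e4 -surjective_pairing.
have bg0 : 0 < orient r p s + orient p q s by rewrite lt_neqAle eq_sym be_ga_neq0; lra.
set t := orient q r s / orient p q r.
set u := orient r p s / (orient r p s + orient p q s).
have t01 : 0 <= t <= 1.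
  by rewrite /t divr_ge0 ?(ltW pqr0)//= ler_pdivrMr// mul1r; lra.
have u01 : 0 <= u <= 1.
  by rewrite /u divr_ge0 ?(ltW bg0)//= ler_pdivrMr// mul1r; lra.
suff -> : s = t *: p + (1 - t) *: (u *: q + (1 - u) *: r).
  by apply: convex_comb => //; exact: convex_comb.
have -> : 1 - t = (orient r p s + orient p q s) / orient p q r.
  by rewrite /t -pqrE; field; rewrite pqrE gt_eqF.
have -> : 1 - u = orient p q s / (orient r p s + orient p q s).
  by rewrite /u; field.
rewrite [LHS]surjective_pairing; congr (_, _); rewrite /= /GRing.scale /= /t /u.
  apply: (mulIf (lt0r_neq0 pqr0)).
  transitivity (orient q r s * p.1 + orient r p s * q.1 + orient p q s * r.1).
    by rewrite /orient /affine /=; ring.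
  by field; rewrite be_ga_neq0 gt_eqF.
apply: (mulIf (lt0r_neq0 pqr0)).
transitivity (orient q r s * p.2 + orient r p s * q.2 + orient p q s * r.2).
  by rewrite /orient /affine /=; ring.
by field; rewrite be_ga_neq0 gt_eqF.
Qed.

(** Near the midpoint of [pq], every point lies in the triangle [p q r] or in the
triangle [p q s], according to its side of the line [pq]. *)
Lemma midpoint_interior X p q r s : X p -> X q -> X r -> X s ->
  0 < orient p q r -> orient p q s < 0 ->
  interior (convex_hull X) ((1 - 2^-1) *: p + 2^-1 *: q).
Proof.
move=> Xp Xq Xr Xs pqr pqs.
pose O := [set t | 0 < orient q r t] `&` [set t | 0 < orient r p t] `&`
  ([set t | 0 < orient p s t] `&` [set t | 0 < orient s q t]).
have oO : open O by apply: openI; apply: openI; exact: open_affine_gt0.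
have OX : O `<=` convex_hull X.
  move=> t [[/= h1 h2] [/= h3 h4]].
  case: (leP 0 (orient p q t)) => h5.
    by apply: (triangle_sub_convex_hull Xp Xq Xr) => //; exact: ltW.
  apply: (triangle_sub_convex_hull Xq Xp Xs); try exact: ltW.
    by move: pqs; rewrite /orient /affine /=; lra.
  by move: h5; rewrite /orient /affine /=; lra.
apply: (@filterS _ _ _ O) => //; apply: open_nbhs_nbhs; split => //.
split; split => /=; move: pqr pqs;
  rewrite /orient /affine /= /GRing.scale /=; lra.
Qed.

Lemma cos2piDz x (n : int) : cos (2 * pi * (x + n%:~R)) = cos (2 * pi * x).
Proof.
have cosn y (k : nat) : cos (2 * pi * (y + k%:R)) = cos (2 * pi * y).
  rewrite -(periodicn (@cosD2pi R) k (2 * pi * y)); congr cos.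
  by rewrite -(mulr_natr (pi *+ 2)) -(mulr_natr pi); ring.
case: n => k; first exact: cosn.
rewrite -(cosn (x + _) k.+1); congr (cos (_ * _)).
by rewrite NegzE intrN -pmulrn; ring.
Qed.

Lemma sin2piDz x (n : int) : sin (2 * pi * (x + n%:~R)) = sin (2 * pi * x).
Proof.
have sinn y (k : nat) : sin (2 * pi * (y + k%:R)) = sin (2 * pi * y).
  rewrite -(periodicn (@sinD2pi R) k (2 * pi * y)); congr sin.
  by rewrite -(mulr_natr (pi *+ 2)) -(mulr_natr pi); ring.
case: n => k; first exact: sinn.
rewrite -(sinn (x + _) k.+1); congr (sin (_ * _)).
by rewrite NegzE intrN -pmulrn; ring.
Qed.

Lemma circle_pt_proj x : circle_pt (proj x) = (cos (2 * pi * x), sin (2 * pi * x)).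
Proof.
by rewrite /circle_pt; have [n ->] := angle_projE x; rewrite cos2piDz sin2piDz.
Qed.

(** Since each factor is periodic up to sign, the orientation of three points of the
circle can be read from any lifts of their angles. *)
Lemma orient_circle_pt x y z :
  orient (circle_pt (proj x)) (circle_pt (proj y)) (circle_pt (proj z)) =
  4 * sin (pi * (y - x)) * sin (pi * (z - y)) * sin (pi * (z - x)).
Proof.
rewrite !circle_pt_proj /orient /affine /=.
set A := 2 * pi * x; set B := 2 * pi * y; set C := 2 * pi * z.
transitivity (sin (B - A) + sin (C - B) - sin ((C - B) + (B - A))).
  have -> : C - B + (B - A) = C - A by ring.
  by rewrite !sinB; ring.
pose u := pi * (y - x); pose v := pi * (z - y).
have -> : B - A = u *+ 2 by rewrite /B /A /u mulr2n; ring.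
have -> : C - B = v *+ 2 by rewrite /B /C /v mulr2n; ring.
have -> : pi * (z - x) = u + v by rewrite /u /v; ring.
rewrite -/u -/v (sinD (v *+ 2)) (sinD u v) !sin_mulr2n !cos_mulr2n !cos2sin2.
by rewrite !mulr2n; ring.
Qed.

Lemma sin_pi_gt0 x : 0 < x < 1 -> 0 < sin (pi * x).
Proof.
move=> /andP[x0 x1]; apply: sin_gt0_pi.
by rewrite mulr_gt0 ?pi_gt0//= -[ltRHS]mulr1 ltr_pM2l ?pi_gt0.
Qed.

Lemma sin_pi_lt0 x : -1 < x < 0 -> sin (pi * x) < 0.
Proof.
move=> x01; rewrite -[x]opprK mulrN sinN oppr_lt0; apply: sin_pi_gt0; lra.
Qed.

Lemma orient_ccw_gt0 x y z : x < y -> y < z -> z < x + 1 ->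
  0 < orient (circle_pt (proj x)) (circle_pt (proj y)) (circle_pt (proj z)).
Proof.
move=> xy yz zx; rewrite orient_circle_pt.
have := @sin_pi_gt0 (y - x); have := @sin_pi_gt0 (z - y).
have := @sin_pi_gt0 (z - x) => h1 h2 h3.
by rewrite !mulr_gt0//; [apply: h3|apply: h2|apply: h1]; lra.
Qed.

Lemma orientC p q r : orient q p r = - orient p q r.
Proof. by rewrite /orient /affine /=; ring. Qed.

Lemma orient_rot p q r : orient q r p = orient p q r.
Proof. by rewrite /orient /affine /=; ring. Qed.

(** Equal points have lifts whose difference [t] satisfies
[1 - cos (2 * pi * t) = 2 * sin (pi * t) ^+ 2 = 0]. *)
Lemma circle_pt_inj : injective (@circle_pt R).
Proof.
move=> a b; rewrite -(angleK a) -(angleK b).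
have := angle_itv a; have := angle_itv b.
move: (angle a) (angle b) => x y y01 x01 xy.
have cos1 : cos ((pi * (x - y)) *+ 2) = 1.
  move: xy; rewrite !circle_pt_proj => -[cxy sxy].
  have -> : (pi * (x - y)) *+ 2 = 2 * pi * x - 2 * pi * y by rewrite mulr2n; ring.
  by rewrite cosB cxy sxy -!expr2 cos2Dsin2.
have sin0 : sin (pi * (x - y)) = 0.
  apply/eqP; rewrite -sqrf_eq0 sin2cos2.
  by move: cos1; rewrite cos_mulr2n => h; apply/eqP; lra.
suff -> : x = y by [].
have [yx|yx|//] := ltgtP y x.
  suff : 0 < sin (pi * (x - y)) by rewrite sin0 ltxx.
  by apply: sin_pi_gt0; lra.
suff : sin (pi * (x - y)) < 0 by rewrite sin0 ltxx.
by apply: sin_pi_lt0; lra.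
Qed.

Lemma segment_mk a b p : segment (mkchord a b) p <->
  exists2 t : R, 0 <= t <= 1 & p = (1 - t) *: circle_pt a + t *: circle_pt b.
Proof.
rewrite /segment; case: (end_mkchord a b) => -[-> ->]; split.
- by move=> [t t01 <-]; exists t.
- by move=> [t t01 ->]; exists t.
- move=> [t /= t01 <-]; exists (1 - t); first by move: t01; lra.
  by rewrite subKr addrC.
- move=> [t t01 ->]; exists (1 - t); first by move: t01 => /=; lra.
  by rewrite subKr addrC.
Qed.

Lemma segment_end l v : is_end l v -> segment l (circle_pt v).
Proof.
rewrite -(mkchord_ends l) is_end_mk segment_mk => -[->|->].
  by exists 0; rewrite ?lexx ?ler01// subr0 scale1r scale0r addr0.
by exists 1; rewrite ?lexx ?ler01// subrr scale1r scale0r add0r.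
Qed.

(** The endpoints of each chord lie strictly on opposite sides of the other.  The
weights that locate the common point on the two chords are ratios of signed
areas with the same denominator [D]. *)
Lemma crossing_not_noncrossing x y z w : x < z -> z < y -> y < w -> w < x + 1 ->
  ~ noncrossing (mkchord (proj x) (proj y)) (mkchord (proj z) (proj w)).
Proof.
move=> xz zy yw wx nc.
set p := circle_pt (proj x); set q := circle_pt (proj y).
set r := circle_pt (proj z); set s := circle_pt (proj w).
have pqr : orient p q r < 0.
  by rewrite -oppr_gt0 -orientC orient_rot orientC -orientC orient_rot; apply: orient_ccw_gt0; lra.
have pqs : 0 < orient p q s by apply: orient_ccw_gt0; lra.
have rsp : 0 < orient r s p by rewrite orient_rot; apply: orient_ccw_gt0; lra.
have rsq : orient r s q < 0.
  rewrite -oppr_gt0 -orientC orient_rot orientC -orientC orient_rot.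
  by apply: orient_ccw_gt0; lra.
pose D := orient p q s - orient p q r.
have DE : D = orient r s p - orient r s q by rewrite /D /orient /affine /=; ring.
have D0 : 0 < D by rewrite /D; lra.
pose t := - orient p q r / D; pose u := orient r s p / D.
pose o := (1 - t) *: r + t *: s.
have t01 : 0 <= t <= 1.
  rewrite /t divr_ge0 ?(ltW D0)//=; last lra.
  by rewrite ler_pdivrMr// mul1r /D; lra.
have u01 : 0 <= u <= 1.
  rewrite /u divr_ge0 ?(ltW D0)//=; last lra.
  by rewrite ler_pdivrMr// mul1r DE; lra.
have oE : o = (1 - u) *: p + u *: q.
  rewrite /o [LHS]surjective_pairing [RHS]surjective_pairing.
  have D_neq0 := lt0r_neq0 D0.
  have -> : 1 - t = orient p q s / D by rewrite /t /D; field.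
  have -> : 1 - u = - orient r s q / D.
    by rewrite /u -[1](divff D_neq0) -mulrBl {1}DE; congr (_ / _); ring.
  rewrite /t /u; congr (_, _); rewrite /= /GRing.scale /= !(mulrAC _ D^-1) -!mulrDl.
    by congr (_ / _); rewrite /orient /affine /=; ring.
  by congr (_ / _); rewrite /orient /affine /=; ring.
have [||v] := nc o.
- by apply/segment_mk; exists u.
- by apply/segment_mk; exists t.
have orso : orient r s o = 0 by rewrite /o /orient /affine /= /GRing.scale /=; ring.
move=> /is_end_mk[->|->] oE'; move: orso; rewrite oE' -/p -/q; lra.
Qed.

Lemma disjoint_chordsP (L : set (chord R)) l m : lamination L -> L l -> L m ->
  (forall v, is_end l v -> ~ is_end m v) -> disjoint_chords l m.
Proof.
move=> [_ nc _] Ll Lm lmv.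
have lm : l <> m by move=> lm; apply: (lmv (end1 l)); [left|rewrite lm; left].
rewrite /disjoint_chords -subset0 => o [lo mo].
have [v lv oE] := nc _ _ Ll Lm lm _ lo mo.
have [w mw oE'] := nc _ _ Lm Ll (nesym lm) _ mo lo.
apply: (lmv v) => //; suff -> : v = w by [].
by apply: circle_pt_inj; rewrite -oE.
Qed.

Lemma disjoint_chords_end l m v : disjoint_chords l m -> is_end l v -> ~ is_end m v.
Proof.
rewrite /disjoint_chords -subset0 => lm lv mv.
by apply: (lm (circle_pt v)); split; exact: segment_end.
Qed.

End PlaneGeometry.

(** * Leaves as sides of the polygon of their class *)

Section Edges.
Context {R : realType}.
Implicit Types (a b c e v : circle R) (x y z w t u : R) (l m : chord R).
Implicit Types (C : set (circle R)) (L : set (chord R)).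

Lemma turn_itv a b : 0 <= turn a b < 1.
Proof. exact: frac_bound. Qed.

Lemma proj_turn a b : proj (angle a + turn a b) = b.
Proof.
rewrite /turn /frac addrA subrKC -intrN projDz; exact: angleK.
Qed.

Lemma turn_proj x t : 0 <= t < 1 -> turn (proj x) (proj (x + t)) = t.
Proof.
move=> t01; rewrite /turn.
have [n ->] := angle_projE x; have [m ->] := angle_projE (x + t).
have -> : x + t + m%:~R - (x + n%:~R) = t + (m - n)%:~R by rewrite intrB; ring.
by rewrite fracDz frac_id.
Qed.

Lemma turn_gt0 a b : a <> b -> 0 < turn a b.
Proof.
move=> ab; rewrite lt_neqAle; have /andP[-> _] := turn_itv a b; rewrite andbT.
apply/eqP => t0; apply: ab.
by rewrite -[LHS]angleK -[RHS](proj_turn a) -t0 addr0.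
Qed.

Lemma turn_sub a b c : turn a b <= turn a c -> turn b c = turn a c - turn a b.
Proof.
move=> abc; rewrite -{1}(proj_turn a b) -{1}(proj_turn a c).
have -> : angle a + turn a c = angle a + turn a b + (turn a c - turn a b) by ring.
by apply: turn_proj; have := turn_itv a b; have := turn_itv a c; lra.
Qed.

Lemma turnC a b : a <> b -> turn b a = 1 - turn a b.
Proof.
move=> ab; rewrite -{1}(proj_turn a b) -[X in turn _ X]angleK -(projD1 (angle a)).
have -> : angle a + 1 = angle a + turn a b + (1 - turn a b) by ring.
by apply: turn_proj; have := turn_itv a b; have := turn_gt0 ab; lra.
Qed.

(** The nearer of [b] and [c] would lie in the open arc from [a] to the farther one. *)
Lemma oriented_edge_uniq_out C a b c :
  oriented_edge C a b -> oriented_edge C a c -> b = c.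
Proof.
wlog bc : b c / turn a b <= turn a c => [hw|] eb ec.
  by case/orP: (le_total (turn a b) (turn a c)) => h; [|symmetry]; apply: hw.
case: eb ec => [Ca Cb ab _] [_ Cc ac C0].
have [tbc|tbc|tbc] := ltgtP (turn a b) (turn a c); last 1 first.
- by rewrite -(proj_turn a b) tbc proj_turn.
- suff : (C `&` arc a c) b by rewrite C0.
  by split => //; rewrite /arc /= tbc turn_gt0.
- by move: bc; rewrite leNgt tbc.
Qed.

Lemma oriented_edge_uniq_in C a b c :
  oriented_edge C b a -> oriented_edge C c a -> b = c.
Proof.
wlog bc : b c / turn a b <= turn a c => [hw|] eb ec.
  by case/orP: (le_total (turn a b) (turn a c)) => h; [|symmetry]; apply: hw.
case: eb ec => [Cb Ca ba C0] [Cc _ ca _].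
have [tbc|tbc|tbc] := ltgtP (turn a b) (turn a c); last 1 first.
- by rewrite -(proj_turn a b) tbc proj_turn.
- suff : (C `&` arc b a) c by rewrite C0.
  split => //; rewrite /arc /= (turn_sub bc) (turnC (nesym ba)) subr_gt0 tbc/=.
  by have := turn_itv a c; lra.
- by move: bc; rewrite leNgt tbc.
Qed.

Lemma finite_set_gt0_min (T : choiceType) (A : set T) (f : T -> R) :
  finite_set A -> (forall p, A p -> 0 < f p) ->
  exists2 r, 0 < r & forall p, A p -> r <= f p.
Proof.
move=> /finite_seqP[s ->]; elim: s => [|x s IH] fs; first by exists 1.
have [|r r0 rs] := IH; first by move=> y ys; apply: fs; rewrite /= in_cons ys orbT.
exists (Num.min r (f x)); first by rewrite lt_min r0 fs//= mem_head.
move=> y /=; rewrite in_cons => /orP[/eqP->|ys]; first by rewrite ge_min lexx orbT.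
by rewrite ge_min rs.
Qed.

(** Slightly inside the tangent at [a] there is a line that leaves the finitely many
points of [C] other than [a], hence the closed hull, on its far side. *)
Lemma closure_hull_circle_pt C a : finite_set C ->
  closure (convex_hull (@circle_pt R @` C)) (circle_pt a) -> C a.
Proof.
move=> finC aC; apply: contrapT => nCa.
(* One minus the scalar product with the unit vector at a. *)
pose f c := affine (- (circle_pt a).1) (- (circle_pt a).2) 1 (circle_pt c).
have [c Cc|r r0 rf] := finite_set_gt0_min (f := f) finC.
  rewrite /f /affine.
  have ac : circle_pt a <> circle_pt c by move=> /circle_pt_inj ac; apply: nCa; rewrite ac.
  have n1 v : (circle_pt v).1 ^+ 2 + (circle_pt v).2 ^+ 2 = 1 by exact: cos2Dsin2.
  have := n1 a; have := n1 c; move: ac.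
  move: (circle_pt a) (circle_pt c) => [a1 a2] [c1 c2] /= ac h1 h2.
  have : 0 < (a1 - c1) ^+ 2 + (a2 - c2) ^+ 2.
    rewrite lt_neqAle addr_ge0 ?sqr_ge0// andbT eq_sym paddr_eq0 ?sqr_ge0//.
    rewrite !sqrf_eq0 !subr_eq0; apply/negP => /andP[/eqP e1 /eqP e2].
    by apply: ac; rewrite e1 e2.
  by rewrite !sqrrB; lra.
pose H := [set p : R^o * R^o |
  0 <= affine (- (circle_pt a).1) (- (circle_pt a).2) (1 - r) p].
have hH : convex_hull (@circle_pt R @` C) `<=` H.
  apply: smallest_sub; first exact: convex_affine_ge0.
  move=> _ [c Cc <-]; have := rf _ Cc; rewrite /H /f /affine /=; lra.
have : H (circle_pt a).
  have := @closed_affine_ge0 R (- (circle_pt a).1) (- (circle_pt a).2) (1 - r).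
  move/closure_id; rewrite -/H => ->; exact: closureS aC.
have : (circle_pt a).1 ^+ 2 + (circle_pt a).2 ^+ 2 = 1 by exact: cos2Dsin2.
by rewrite /H /affine /=; lra.
Qed.

(** If [C] had points on both sides of [ab], the midpoint of [ab] would be interior
to the hull. *)
Lemma edge_of_boundary C a b : finite_set C -> a <> b ->
  segment (mkchord a b) `<=` boundary (convex_hull (@circle_pt R @` C)) ->
  oriented_edge C a b \/ oriented_edge C b a.
Proof.
move=> finC ab abC.
have Ca : C a.
  apply: closure_hull_circle_pt => //.
  by have [] := abC _ (segment_end (proj2 (is_end_mk a b a) (or_introl erefl))).
have Cb : C b.
  apply: closure_hull_circle_pt => //.
  by have [] := abC _ (segment_end (proj2 (is_end_mk a b b) (or_intror erefl))).
apply: contrapT => /not_orP[eab eba].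
have [c Cc /andP[c1 c2]] : exists2 c, C c & arc a b c.
  apply: contrapT => h; apply: eab; split=> //; rewrite -subset0 => c [Cc abc].
  by apply: h; exists c.
have [e Ce /andP[e1 e2]] : exists2 e, C e & arc b a e.
  apply: contrapT => h; apply: eba; split=> //; first exact: nesym.
  by rewrite -subset0 => e [Ce bae]; apply: h; exists e.
have tab := turn_itv a b.
set x := angle a; set y := x + turn a b.
have aE : circle_pt a = circle_pt (proj x) by rewrite angleK.
have bE : circle_pt b = circle_pt (proj y) by rewrite proj_turn.
have cE : circle_pt c = circle_pt (proj (x + turn a c)) by rewrite proj_turn.
have eE : circle_pt e = circle_pt (proj (y + turn b e)).
  have [n nE] := angle_projE y.
  congr circle_pt; rewrite -[LHS](proj_turn b); have -> : angle b = y + n%:~R.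
    by rewrite -nE proj_turn.
  by rewrite addrAC projDz.
rewrite (turnC ab) in e2.
have abe : 0 < orient (circle_pt a) (circle_pt b) (circle_pt e).
  by rewrite aE bE eE; apply: orient_ccw_gt0; rewrite /y; lra.
have abc : orient (circle_pt a) (circle_pt b) (circle_pt c) < 0.
  rewrite -oppr_gt0 -orientC -orient_rot aE bE cE.
  by apply: orient_ccw_gt0; rewrite /y; lra.
have [|_ h] := abC ((1 - 2^-1) *: circle_pt a + 2^-1 *: circle_pt b).
  by apply/segment_mk; exists 2^-1 => //; lra.
apply: h; apply: (midpoint_interior _ _ _ _ abe abc) => //.
Qed.

Definition lam_class_of L a : set (circle R) := [set b | lam_equiv L a b].

Lemma lam_class_ofE L a C : lam_class L C -> C a -> C = lam_class_of L a.
Proof.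
move=> [a0 ->] a0a; apply/seteqP; split => b /= h.
  exact: rst_trans (rst_sym _ _ _ _ a0a) h.
exact: rst_trans a0a h.
Qed.

(** This is what makes the classes of a lamination with finitely many leaves finite. *)
Lemma lam_equiv_end L a b : lam_equiv L a b -> a = b \/
  (exists2 l, leaf L l & is_end l a) /\ (exists2 l, leaf L l & is_end l b).
Proof.
elim=> {a b} [a b ab|a|a b _ [->|[]]|a b c _ h1 _ h2]; [right|left|left|right|] => //.
  by split; exists (mkchord a b) => //; apply/is_end_mk; auto.
case: h1 => [->//|[al bl]]; case: h2 => [<-|[bl' cl]]; by right.
Qed.

Lemma finite_lam_class L C :
  finite_set [set l | leaf L l] -> lam_class L C -> finite_set C.
Proof.
move=> finL [a ->].
apply: (@sub_finite_set _ _ ([set a] `|` (@end1 R @` [set l | leaf L l] `|`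
  @end2 R @` [set l | leaf L l]))).
  move=> b /= /lam_equiv_end[->|[_ [l Ll [->|->]]]]; [by left|right; left|right; right].
    by exists l.
  by exists l.
by rewrite !finite_setU; split; [exact: finite_set1|split; exact: finite_image].
Qed.

Lemma FDL_edge d L a b : FDL d L -> leaf L (mkchord a b) ->
  oriented_edge (lam_class_of L a) a b \/ oriented_edge (lam_class_of L a) b a.
Proof.
move=> FL [Lab nab]; have [C CL abC] := (fdl_hull FL nab).1 Lab.
have ab : a <> b by move=> ab; apply: nab; apply/degenerate_mk.
have := edge_of_boundary (finite_lam_class (fdl_finite FL) CL) ab abC.
move=> h; have Ca : C a by case: h => -[].
by rewrite -(lam_class_ofE CL Ca).
Qed.

(** Every leaf at [a] is the side of the polygon of the class of [a] that leaves [a]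
or the one that enters it. *)
Lemma FDL_vertex d L a b1 b2 b3 : FDL d L ->
  leaf L (mkchord a b1) -> leaf L (mkchord a b2) -> leaf L (mkchord a b3) ->
  [\/ b1 = b2, b1 = b3 | b2 = b3].
Proof.
move=> FL /(FDL_edge FL) e1 /(FDL_edge FL) e2 /(FDL_edge FL) e3.
have o := @oriented_edge_uniq_out (lam_class_of L a) a.
have i := @oriented_edge_uniq_in (lam_class_of L a) a.
case: e1 => e1; case: e2 => e2; case: e3 => e3.
all: try by constructor 1; (exact: o e1 e2 || exact: i e1 e2).
all: try by constructor 2; (exact: o e1 e3 || exact: i e1 e3).
all: by constructor 3; (exact: o e2 e3 || exact: i e2 e3).
Qed.

Lemma leaf_chord_map d L l : FDL d L -> leaf L l -> leaf L (chord_map d l).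
Proof.
move=> FL Ll; split; first exact: (fdl_forward FL).
rewrite /chord_map => /degenerate_mk; apply: (fdl_noncritical FL).
by rewrite mkchord_ends.
Qed.

Lemma lam_equiv_sigma d L a b : FDL d L ->
  lam_equiv L a b -> lam_equiv L (sigma d a) (sigma d b).
Proof.
move=> FL; elim=> {a b} [a b ab|a|a b _|a b c _ + _].
- by apply: rst_step; rewrite -chord_map_mk; exact: leaf_chord_map.
- exact: rst_refl.
- exact: rst_sym.
- exact: rst_trans.
Qed.

Lemma lam_equiv_iter d L a b k : FDL d L ->
  lam_equiv L a b -> lam_equiv L (iter k (sigma d) a) (iter k (sigma d) b).
Proof. by move=> FL ab; elim: k => //= k; exact: lam_equiv_sigma. Qed.

(** A point [c] of the class of [sigma a] is the image of its own periodic
predecessor, and that predecessor is equivalent to [a] because both arise by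
iterating [sigma] the same number of times from [c] and [sigma a]. *)
Lemma image_periodic_class d L a : FDL d L ->
  (forall c, lam_equiv L (sigma d a) c -> periodic_point d c) -> periodic_point d a ->
  sigma d @` lam_class_of L a = lam_class_of L (sigma d a).
Proof.
move=> FL pc [k k0 ka]; apply/seteqP; split => [_ [b ab <-]|c /= ac].
  exact: lam_equiv_sigma.
have [m m0 mc] := pc _ ac.
have km : (0 < k * m)%N by rewrite muln_gt0 k0.
(* k * m is a common period of a and c. *)
exists (iter (k * m).-1 (sigma d) c); last first.
  by rewrite -iterS prednK// (iter_mul_fix k mc).
rewrite /lam_class_of /= -[X in lam_equiv _ X](iter_mul_fix m ka) mulnC -(prednK km).
by rewrite iterSr; exact: lam_equiv_iter.
Qed.

(** Equivalence propagates periodicity, so the class of [a] and its images are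
periodic classes, and [sigma] maps sides to sides along the orbit.  After [k]
steps the side leaving (or entering) [a] through [b] returns to a side leaving
(or entering) [a], and there is just one. *)
Lemma FDL_fix d L a b k : FDL d L ->
  (forall a b, leaf L (mkchord a b) -> periodic_point d a -> periodic_point d b) ->
  leaf L (mkchord a b) -> (0 < k)%N -> iter k (sigma d) a = a ->
  iter k (sigma d) b = b.
Proof.
move=> FL per Lab k0 ka.
have pa : periodic_point d a by exists k.
have pclass c e : lam_equiv L c e -> (periodic_point d c <-> periodic_point d e).
  elim=> {c e} [c e ce|c|c e _ [h1 h2]|c e v _ [h1 h2] _ [h3 h4]]; split; auto.
  - exact: per.
  - by apply: per; rewrite mkchordC.
have img j : sigma d @` lam_class_of L (iter j (sigma d) a) =
    lam_class_of L (iter j.+1 (sigma d) a).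
  apply: image_periodic_class => //; last exact: periodic_point_iter.
  by move=> c /pclass <-; rewrite -iterS; exact: periodic_point_iter.
have imgk i j : iter i (sigma d) @` lam_class_of L (iter j (sigma d) a) =
    lam_class_of L (iter (i + j) (sigma d) a).
  elim: i => [|i IH]; first by rewrite image_id.
  by rewrite addSn -img -IH -image_comp.
have edge c e j : oriented_edge (lam_class_of L a) c e ->
  oriented_edge (lam_class_of L (iter j (sigma d) a))
    (iter j (sigma d) c) (iter j (sigma d) e).
  move=> ce; elim: j => [//|j IH]; rewrite -img; apply: (fdl_covering FL) => //.
    by exists (iter j (sigma d) a).
  by exists k => //; rewrite imgk addnC iterD ka.
have := FDL_edge FL Lab => -[] ab; have := edge _ _ k ab; rewrite ka => ab'.
  exact: oriented_edge_uniq_out ab' ab.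
exact: oriented_edge_uniq_in ab' ab.
Qed.

Lemma chord_preimage d l t u : (0 < d)%N ->
  chord_map d l = mkchord (proj t) (proj u) -> exists i j : 'I_d,
  l = mkchord (proj ((t + i%:R) / d%:R)) (proj ((u + j%:R) / d%:R)).
Proof.
move=> d0; rewrite -(mkchord_ends l) chord_map_mk.
move=> /mkchord_inj[[/(sigma_preimage d0)[i iE] /(sigma_preimage d0)[j jE]]
                   |[/(sigma_preimage d0)[j jE] /(sigma_preimage d0)[i iE]]].
  by exists i, j; rewrite iE jE.
by exists i, j; rewrite iE jE mkchordC.
Qed.

Lemma sigma_preimageK d x (i : 'I_d) : sigma d (proj ((x + i%:R) / d%:R)) = proj x.
Proof.
have dn0 : d%:R != 0 :> R by rewrite pnatr_eq0 -lt0n; case: d i => [[]|].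
by rewrite sigma_proj mulrC divfK//; exact: (projDz x i).
Qed.

(** A chord over [mkchord (proj t) (proj u)] joins one of the [d] preimages of
[proj t] to one of the [d] preimages of [proj u].  Disjoint chords share no
endpoint, so [d] of them use every preimage exactly once. *)
Lemma sibling_matching d (f : 'I_d -> chord R) t u : (0 < d)%N ->
  (forall i, chord_map d (f i) = mkchord (proj t) (proj u)) ->
  (forall i j, i <> j -> disjoint_chords (f i) (f j)) ->
  exists p q : 'I_d -> 'I_d, [/\ injective p, injective q &
    forall i, f i = mkchord (proj ((t + (p i)%:R) / d%:R))
                            (proj ((u + (q i)%:R) / d%:R))].
Proof.
move=> d0 fE fdisj.
have /choice[pq pqE] i : exists pq : 'I_d * 'I_d,
    f i = mkchord (proj ((t + pq.1%:R) / d%:R)) (proj ((u + pq.2%:R) / d%:R)).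
  by have [j [k fiE]] := chord_preimage d0 (fE i); exists (j, k).
exists (fst \o pq), (snd \o pq); split => // i j /= ij; apply: contrapT => nij.
  apply: (disjoint_chords_end (fdisj _ _ nij) (v := proj ((t + (pq i).1%:R) / d%:R))).
    by rewrite pqE; apply/is_end_mk; left.
  by rewrite pqE; apply/is_end_mk; left; rewrite ij.
apply: (disjoint_chords_end (fdisj _ _ nij) (v := proj ((u + (pq i).2%:R) / d%:R))).
  by rewrite pqE; apply/is_end_mk; right.
by rewrite pqE; apply/is_end_mk; right; rewrite ij.
Qed.

Lemma siblings_at_preimage d (f : 'I_d -> chord R) a b a1 : (0 < d)%N ->
  (forall i, chord_map d (f i) = mkchord a b) ->
  (forall i j, i <> j -> disjoint_chords (f i) (f j)) -> sigma d a1 = a ->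
  exists i b1, f i = mkchord a1 b1 /\ sigma d b1 = b.
Proof.
move=> d0 fE fdisj a1a; rewrite -(angleK a) -(angleK b) in fE.
have [p [q [pinj _ pqE]]] := sibling_matching d0 fE fdisj.
rewrite -(angleK a) in a1a; have [j jE] := sigma_preimage d0 a1a.
have [p' _ p'K] := injF_bij pinj; exists (p' j).
exists (proj ((angle b + (q (p' j))%:R) / d%:R)); split; first by rewrite pqE p'K jE.
by rewrite sigma_preimageK angleK.
Qed.

End Edges.

(** * Hausdorff distance *)

Section Hausdorff.
Context {R : realType}.
Implicit Types (A B : set (chord R)) (l m : chord R) (e : R).

Lemma inf_chord_dist_le2 (F : set R) : F !=set0 ->
  (forall r, F r -> 0 <= r <= 2) -> inf F <= 2.
Proof.
move=> [r Fr] F02; apply: (@le_trans _ _ r); last by have /andP[] := F02 _ Fr.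
by apply: ge_inf => //; exists 0 => x /F02/andP[].
Qed.

(** All chord distances lie between [0] and [2], so the supremum in the Hausdorff
distance is a genuine upper bound. *)
Lemma hausdorff_dist_lt A B e : B !=set0 -> hausdorff_dist A B < e ->
  forall l, A l -> exists2 m, B m & chord_dist l m < e.
Proof.
move=> [m0 Bm0]; rewrite /hausdorff_dist gt_max => /andP[+ _] l Al.
have d02 l' m r : chord_dist l' m = r -> 0 <= r <= 2.
  by move=> <-; rewrite chord_dist_ge0 chord_dist_le2.
set S := [set inf _ | _ in _] => Se.
have : inf [set chord_dist l m | m in B] < e.
  apply: le_lt_trans Se; apply: ub_le_sup; last by exists l.
  exists 2 => _ [l' _ <-]; apply: inf_chord_dist_le2.
    by exists (chord_dist l' m0), m0.
  by move=> r [m _]; exact: d02.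
move/inf_lt => [|_ [m Bm <-] lm]; first by exists (chord_dist l m0), m0.
by exists m.
Qed.

Lemma hausdorff_distC A B : hausdorff_dist A B = hausdorff_dist B A.
Proof.
rewrite /hausdorff_dist maxC; congr Num.max; congr sup; apply: eq_imagel => l _;
  by congr inf; apply: eq_imagel => m _; rewrite chord_distC.
Qed.

End Hausdorff.

(** * Sequences to the end of a pullback tree *)

Section Sequences.
Context {R : realType}.
Variables (d : nat) (P : set (chord R)) (Ls : nat -> set (chord R)).
Hypothesis Ls_seq : sequence_to_end d P Ls.
Implicit Types (a b c : circle R) (l : chord R) (n m : nat).

Lemma seq_FDL n : FDL d (Ls n).
Proof. by case: Ls_seq => /(_ n)[]. Qed.

Lemma seq_leaf_preimage n l : leaf (Ls n) l ->
  exists2 m, leaf (Ls n.+1) m & chord_map d m = l.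
Proof.
case: Ls_seq => _ _ /(_ n)[<- _] [[[m Lm <-]|] nl]; last by [].
by exists m.
Qed.

Lemma seq_subS n : Ls n `<=` Ls n.+1.
Proof.
case: Ls_seq => _ _ /(_ n)[<- _] l [[m Lm <-]|dl].
  exact: (fdl_forward (seq_FDL n.+1)).
by have [_ _] := fdl_lamination (seq_FDL n.+1); exact.
Qed.

Lemma seq_sub n m : (n <= m)%N -> Ls n `<=` Ls m.
Proof.
move=> /subnKC <-; elim: (m - n)%N => [|k IH]; first by rewrite addn0.
by rewrite addnS; apply: subset_trans IH _; exact: seq_subS.
Qed.

Lemma seq_leaf_sub n m l : (n <= m)%N -> leaf (Ls n) l -> leaf (Ls m) l.
Proof. by move=> nm [Ll ?]; split => //; exact: seq_sub nm _ Ll. Qed.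

(** All FDL of the tree have the same periodic leaves. *)
Lemma seq_periodic_leaf n m l : leaf (Ls n) l -> periodic_chord d l -> leaf (Ls m) l.
Proof.
case: Ls_seq => tree _ _ Ll pl.
have /(congr1 (@^~ l)) := (tree n).2; rewrite -(tree m).2 /= => E.
suff : [set l | leaf (Ls m) l /\ periodic_chord d l] l by case.
by rewrite /= -E.
Qed.

(** By the depth condition it suffices that the depth [n] of [Ls 1] is not [0].
[Ls 1] differs from its image [Ls 0], hence has a non-periodic leaf [m].  Depth
[0] forbids [m] as a preimage, both of a non-periodic and of a periodic leaf. *)
Lemma seq_periodic_leaf_preimage l : leaf (Ls 1) l -> periodic_chord d l ->
  exists l' : chord R, [/\ leaf (Ls 1) l', ~ periodic_chord d l' & chord_map d l' = l].
Proof.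
move=> Ll pl; have [n [np p]] := fdl_depth (seq_FDL 1).
apply/(p _ Ll pl); rewrite lt0n; apply/eqP => n0; rewrite n0 in np p.
have [m [Lm nm]] : exists m : chord R, leaf (Ls 1) m /\ ~ periodic_chord d m.
  apply: contrapT => h.
  case: (Ls_seq) => _ _ /(_ 0%N)[_]; apply; apply/seteqP; split; last exact: seq_subS.
  move=> m Lm; have [dm|ndm] := pselect (degenerate m).
    by have [_ _] := fdl_lamination (seq_FDL 0); exact.
  have L1m : leaf (Ls 1) m by [].
  suff pm : periodic_chord d m by case: (seq_periodic_leaf 0 L1m pm).
  by apply: contrapT => pm; apply: h; exists m.
have Lm' := leaf_chord_map (seq_FDL 1) Lm.
have [pm'|nm'] := pselect (periodic_chord d (chord_map d m)).
  by have : (0 < 0)%N by apply/(p _ Lm' pm'); exists m.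
by apply: (nm'); apply/(np _ Lm' nm'); exists m.
Qed.

Hypothesis d2 : (2 <= d)%N.

Let d0 : (0 < d)%N. Proof. exact: ltnW. Qed.

(** A preimage of the leaf in the next FDL is again non-periodic, so it comes with
siblings, and one of these starts at the prescribed preimage [a1]. *)
Lemma seq_pull n a b a1 : leaf (Ls n) (mkchord a b) -> ~ periodic_point d b ->
  sigma d a1 = a ->
  exists2 b1, leaf (Ls n.+1) (mkchord a1 b1) & sigma d b1 = b.
Proof.
move=> /seq_leaf_preimage[m Lm mE] nb a1a.
have nm : ~ periodic_chord d m.
  by move/periodic_chord_map; rewrite mE => /periodic_chord_mk[].
have [f [_ fL fdisj]] := fdl_siblings (seq_FDL n.+1) Lm nm.
have fE i : chord_map d (f i) = mkchord a b by rewrite (fL i).2.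
have [i [b1 [fiE b1b]]] := siblings_at_preimage d0 fE fdisj a1a.
by exists b1 => //; rewrite -fiE; exact: (fL i).1.
Qed.

Lemma seq_pull_iter k n a b a1 : leaf (Ls n) (mkchord a b) ->
  ~ periodic_point d b -> iter k (sigma d) a1 = a ->
  exists2 b1, leaf (Ls (n + k)) (mkchord a1 b1) & iter k (sigma d) b1 = b.
Proof.
move=> Lab nb; elim: k a1 => [|k IH] a1.
  by move=> /= ->; exists b => //; rewrite addn0.
rewrite iterSr => /IH[b1 Lb1 b1b].
have nb1 : ~ periodic_point d b1.
  by move=> pb1; apply: nb; rewrite -b1b; exact: periodic_point_iter.
have [b2 Lb2 b2b1] := seq_pull Lb1 nb1 erefl.
by exists b2; [rewrite addnS|rewrite iterSr b2b1].
Qed.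

(** Pulling [ab] back once and twice around the orbit of [a] gives leaves
[mkchord a b1] and [mkchord a b2]; if [b] is not periodic, then [b], [b1] and
[b2] are distinct. *)
Lemma seq_periodic_end n a b : leaf (Ls n) (mkchord a b) ->
  periodic_point d a -> periodic_point d b.
Proof.
move=> Lab [k k0 ka]; apply: contrapT => nb.
have [b1 Lb1 b1b] := seq_pull_iter Lab nb ka.
have nb1 : ~ periodic_point d b1.
  by move=> pb1; apply: nb; rewrite -b1b; exact: periodic_point_iter.
have [b2 Lb2 b2b1] := seq_pull_iter Lb1 nb1 ka.
have := FDL_vertex (seq_FDL (n + k + k)) (seq_leaf_sub _ Lab) (seq_leaf_sub _ Lb1) Lb2.
case; [by rewrite -addnA leq_addr|by rewrite leq_addr|..] => e.
- by apply: nb; exists k => //; rewrite {1}e.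
- by apply: nb; exists (k + k)%N; [rewrite addn_gt0 k0|rewrite iterD {1}e b2b1].
- by apply: nb1; exists k => //; rewrite {1}e.
Qed.

Lemma seq_fix n a b k : leaf (Ls n) (mkchord a b) -> (0 < k)%N ->
  iter k (sigma d) a = a -> iter k (sigma d) b = b.
Proof. by apply: FDL_fix; [exact: seq_FDL|exact: seq_periodic_end]. Qed.

(** The definition of FDL gives siblings only to non-periodic leaves.  For a periodic
[l] the siblings of a non-periodic leaf with the same image serve as well: one of
them starts at [end1 l], so it ends at a periodic preimage of the image of
[end2 l], that is, at [end2 l]. *)
Lemma seq_siblings n l : leaf (Ls n) l -> exists k, has_siblings d (Ls k) l.
Proof.
move=> Ll; have [pl|nl] := pselect (periodic_chord d l); last first.
  by exists n; exact: (fdl_siblings (seq_FDL n)).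
exists 1%N; set a := end1 l; set b := end2 l.
have lE : l = mkchord a b by rewrite mkchord_ends.
have [pa pb] : periodic_point d a /\ periodic_point d b.
  by apply: periodic_chord_mk; rewrite -lE.
have L1 : leaf (Ls 1) (chord_map d l).
  apply: seq_periodic_leaf (periodic_chord_map pl).
  exact: leaf_chord_map (seq_FDL n) Ll.
have [m [Lm nm mE]] := seq_periodic_leaf_preimage L1 (periodic_chord_map pl).
have [f [_ fL fdisj]] := fdl_siblings (seq_FDL 1) Lm nm.
have fE i : chord_map d (f i) = mkchord (sigma d a) (sigma d b).
  by rewrite (fL i).2 mE.
have [i [b1 [fiE b1b]]] := siblings_at_preimage d0 fE fdisj (erefl (sigma d a)).
exists f; split => //; last by move=> j; rewrite -mE.
exists i; rewrite fiE lE; congr mkchord; apply: periodic_sigma_inj b1b => //.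
by apply: (@seq_periodic_end 1 a) => //; rewrite -fiE; exact: (fL i).1.
Qed.

End Sequences.

(** * The closure of an invariant family of chords *)

Section Limit.
Context {R : realType}.
Implicit Types (a b c : circle R) (l m : chord R) (x y t u e : R).

(** Non-integrality is an open condition. *)
Lemma int_gap x : (forall n : int, x <> n%:~R) ->
  exists2 e, 0 < e & forall t (n : int), `|t| < e -> x + t <> n%:~R.
Proof.
move=> xZ; have /andP[x0 x1] := floor_itv x.
exists (Num.min (x - (Num.floor x)%:~R) ((Num.floor x + 1)%:~R - x)).
  rewrite lt_min !subr_gt0 x1 andbT lt_neqAle x0 andbT.
  by apply/eqP => /esym; exact: xZ.
move=> t n; rewrite lt_min !ltr_norml => /andP[/andP[t1 t2] /andP[t3 t4]] xt.
have : (Num.floor x)%:~R < n%:~R :> R by lra.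
have : n%:~R < (Num.floor x + 1)%:~R :> R by lra.
by rewrite !ltr_int; lia.
Qed.

(** Pigeonhole over a finite set of cases.  It plays the part of compactness when
approximants of a chord are replaced by their preimages. *)
Lemma finite_choice_small (T : finType) (Q : T -> R -> Prop) :
  (forall z e e', e <= e' -> Q z e -> Q z e') ->
  (forall e, 0 < e -> exists z, Q z e) -> exists z, forall e, 0 < e -> Q z e.
Proof.
move=> Qmono Qex; apply: contrapT => h.
have /choice[r rP] z : exists r, 0 < r /\ ~ Q z r.
  apply: contrapT => hz; apply: h; exists z => e e0; apply: contrapT => nQ.
  by apply: hz; exists e.
have [z|e e0 er] := @finite_set_gt0_min R T setT r finite_finset; first by case: (rP z).
have [z Qz] := Qex e e0; have [_] := rP z; apply.
exact: Qmono (er z I) Qz.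
Qed.

(** The properties of the union of the leaves of a sequence that determine the
behaviour of its closure. *)
Record invariant_core (d : nat) (U : set (chord R)) : Prop := {
  core_nondegenerate : forall l, U l -> ~ degenerate l;
  core_forward : forall l, U l -> U (chord_map d l);
  core_preimage : forall l, U l -> exists2 m, U m & chord_map d m = l;
  core_siblings : forall l, U l -> exists f : 'I_d -> chord R,
    [/\ exists i, f i = l,
        forall i, U (f i) /\ chord_map d (f i) = chord_map d l &
        forall i j, i <> j -> disjoint_chords (f i) (f j)];
  core_fix : forall a b k, U (mkchord a b) -> (0 < k)%N ->
    iter k (sigma d) a = a -> iter k (sigma d) b = b }.

Variables (d : nat) (U L : set (chord R)).
Hypothesis d2 : (2 <= d)%N.
Hypothesis core : invariant_core d U.
Hypothesis lamL : lamination L.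
Hypothesis UL : U `<=` L.
Hypothesis Udense : forall l e, leaf L l -> 0 < e ->
  exists2 m, U m & chord_dist l m < e.

Let d0 : (0 < d)%N. Proof. exact: ltnW. Qed.
Let dR : 2 <= d%:R :> R. Proof. by rewrite (ler_nat R 2). Qed.

Let dR_gt0 : 0 < d%:R :> R. Proof. by rewrite ltr0n. Qed.

Let dR_ge1 : 1 <= d%:R :> R. Proof. by rewrite ler1n. Qed.

(** Closedness of [L], in terms of lifts. *)
Lemma limit_closed x y : (forall e, 0 < e -> exists t u,
    [/\ `|t| < e, `|u| < e & L (mkchord (proj (x + t)) (proj (y + u)))]) ->
  L (mkchord (proj x) (proj y)).
Proof.
case: lamL => Lcl _ _ h; apply: Lcl => e e0.
have [t [u [te ue Ltu]]] := h (e / 2) (divr_gt0 e0 (ltr0Sn _ 1)).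
exists (mkchord (proj (x + t)) (proj (y + u))) => //.
by apply: le_lt_trans (chord_dist_le _ _ _ _) _; lra.
Qed.

Lemma limit_dense x y e : leaf L (mkchord (proj x) (proj y)) -> 0 < e ->
  exists t u, [/\ `|t| < e, `|u| < e & U (mkchord (proj (x + t)) (proj (y + u)))].
Proof.
move=> Lxy e0; have [m Um /chord_dist_lt[t [u [te ue mE]]]] := Udense Lxy e0.
by exists t, u; rewrite -mE.
Qed.

Lemma limit_degenerate a : L (mkchord a a).
Proof. by case: lamL => _ _; apply; apply/degenerate_mk. Qed.

Lemma limit_leaf_or_point l : L l -> leaf L l \/ degenerate l.
Proof. by move=> Ll; have [|] := pselect (degenerate l); [right|left]. Qed.

Lemma limit_forward l : L l -> L (chord_map d l).
Proof.
move=> /limit_leaf_or_point[Ll|dl]; last first.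
  by rewrite /chord_map dl; exact: limit_degenerate.
have [x [y lE]] := chordP l; rewrite lE in Ll *.
rewrite chord_map_mk !sigma_proj; apply: limit_closed => e e0.
have [|t [u [te ue Utu]]] := limit_dense (e := e / d%:R) Ll.
  by rewrite divr_gt0.
exists (d%:R * t), (d%:R * u); split.
- by rewrite normrM ger0_norm// mulrC -ltr_pdivlMr.
- by rewrite normrM ger0_norm// mulrC -ltr_pdivlMr.
- by rewrite -!mulrDr -!sigma_proj -chord_map_mk; apply: UL; exact: core_forward.
Qed.

Lemma limit_iter k l : L l -> L (iter k (chord_map d) l).
Proof. by move=> Ll; elim: k => //= k; exact: limit_forward. Qed.

Lemma core_iter k l : U l -> U (iter k (chord_map d) l).
Proof. by move=> Ul; elim: k => //= k; exact: core_forward. Qed.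

Lemma limit_noncrossing x y z w : x < z -> z < y -> y < w -> w < x + 1 ->
  L (mkchord (proj x) (proj y)) -> L (mkchord (proj z) (proj w)) -> False.
Proof.
move=> xz zy yw wx L1 L2; case: lamL => _ nc _.
apply: (crossing_not_noncrossing xz zy yw wx); apply: nc => //.
move=> /mkchord_inj[[/proj_inj_lt1 e _]|[/proj_inj_lt1 e _]].
  have : x = z by apply: e; rewrite ltr_norml; lra.
  lra.
have : x = w by apply: e; rewrite ltr_norml; lra.
lra.
Qed.

(** The point at distance [t] from [proj al] in the direction [s]; the two
directions allow the same argument on both sides of a leaf. *)
Definition reach (s : bool) (al t : R) : circle R :=
  proj (al + (if s then t else - t)).

Lemma reach_noncrossing s al x y z w : x < z -> z < y -> y < w -> w < x + 1 ->
  L (mkchord (reach s al x) (reach s al y)) ->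
  L (mkchord (reach s al z) (reach s al w)) -> False.
Proof.
move=> xz zy yw wx; case: s; rewrite /reach.
  by apply: limit_noncrossing; lra.
rewrite mkchordC (mkchordC (proj (al - z))) => L1 L2.
by apply: (limit_noncrossing _ _ _ _ L2 L1); lra.
Qed.

Lemma reachDz s al t (n : int) : reach s al (t + n%:~R) = reach s al t.
Proof.
rewrite /reach; case: s; first by rewrite addrA projDz.
by rewrite opprD addrA -intrN projDz.
Qed.

Lemma reach_inj s al t u : `|t - u| < 1 -> reach s al t = reach s al u -> t = u.
Proof.
move=> tu; rewrite /reach; case: s => /proj_inj_lt1 e.
  by apply: (addrI al); apply: e; rewrite opprD addrACA subrr add0r.
apply: oppr_inj; apply: (addrI al); apply: e.
by rewrite opprD addrACA subrr add0r -opprD normrN.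
Qed.

Lemma iter_sigma_reach s al k t : iter k (sigma d) (proj al) = proj al ->
  iter k (sigma d) (reach s al t) = reach s al (d%:R ^+ k * t).
Proof.
rewrite /reach !iter_sigma_proj => /esym/proj_eqP[n nE].
rewrite mulrDr nE; case: s; rewrite ?mulrN.
  by rewrite addrAC projDz.
by rewrite addrAC projDz.
Qed.

(** The iterate of [sigma] acts near its fixed point as multiplication by [D] of the
coordinate [reach s al].  Let [ga] be the coordinate of the image of [b].
If [ga > be], the image of a chord near [ab] crosses [ab]; if [0 < ga < be], the
image of [ab] crosses such a chord.  If [ga = 0], either the chord or its image
crosses [ab] unless the chord ends at [b], and then its image ends at [a] and
would have to be fixed. *)
Lemma no_leaf_on_side s al be k : 0 < be < 1 -> (0 < k)%N ->
  L (mkchord (reach s al 0) (reach s al be)) ->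
  iter k (sigma d) (reach s al 0) = reach s al 0 ->
  iter k (sigma d) (reach s al be) <> reach s al be ->
  exists2 e, 0 < e & forall t u, 0 < t < e -> `|u| < e ->
    ~ U (mkchord (reach s al t) (reach s al (be + u))).
Proof.
move=> be01 k0 Lab fixa nfixb.
have fixal : iter k (sigma d) (proj al) = proj al.
  by move: fixa; rewrite /reach oppr0 if_same addr0.
have img t := iter_sigma_reach s t fixal.
set D : R := d%:R ^+ k in img.
have D2 : 2 <= D.
  rewrite /D -(prednK k0) exprS; apply: le_trans dR _.
  by rewrite ler_peMr// exprn_ege1.
pose ga := frac (D * be).
have ga01 : 0 <= ga < 1 by exact: frac_bound.
have gaE t : reach s al (D * be + t) = reach s al (ga + t).
  rewrite /ga /frac addrAC -intrN reachDz //.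
have ga_be : ga != be.
  apply/eqP => E; apply: nfixb; rewrite img -[D * be]addr0 gaE addr0 E//.
have Limg : L (mkchord (reach s al 0) (reach s al ga)).
  have := limit_iter k Lab; rewrite iter_chord_map_mk !img mulr0.
  by rewrite -[D * be]addr0 gaE addr0.
(* Powers of D up to the square enlarge the perturbations, so their bound is a
   margin ka for all position tests divided by that square. *)
pose ka := Num.min (Num.min be (1 - be)) (Num.min `|ga - be|
  (Num.min (if ga == 0 then 1 else ga) (1 - ga))).
have ka0 : 0 < ka.
  rewrite !lt_min normr_gt0 subr_eq0 ga_be.
  by case: eqP => [_|/eqP ga0]; rewrite ?(lt0r ga) ?ga0; lra.
have kaP r : r < ka -> [/\ r < be, r < 1 - be, r < `|ga - be|,
   r < (if ga == 0 then 1 else ga) & r < 1 - ga].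
  by rewrite /ka !lt_min => /andP[/andP[? ?] /andP[? /andP[? ?]]].
exists (ka / (D * D)); first by rewrite divr_gt0//; nra.
move=> t u /andP[t0]; rewrite !ltr_pdivlMr; [|nra|nra] => te ue Utu.
have tD : t <= D * t by nra.
have tDD : D * t <= D * (D * t) by nra.
have [t1 t2 t3 t4 t5] := kaP (D * (D * t)) ltac:(nra).
have u0 := normr_ge0 u.
have [u1 u2 u3 u4 u5] := kaP (D * `|u|) ltac:(nra).
have uD : `|u| <= D * `|u| by nra.
have DuE : `|D * u| = D * `|u| by rewrite normrM (ger0_norm (x := D))//; lra.
have := ler_norm u; have := ler_norm (- u); rewrite normrN => uN uP.
have := ler_norm (D * u); have := ler_norm (- (D * u)); rewrite normrN DuE => DuN DuP.
have Uimg : U (mkchord (reach s al (D * t)) (reach s al (ga + D * u))).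
  have := core_iter k Utu; rewrite iter_chord_map_mk !img.
  by rewrite [D * (be + u)]mulrDr gaE.
have [ga_lt|ga_gt|ga_eq] := ltgtP ga be; last by rewrite ga_eq eqxx in ga_be.
  have [ga0|ga0] := eqVneq ga 0.
    rewrite ga0 add0r in Uimg.
    have [u_lt0|u_gt0|u_eq0] := ltgtP u 0.
    (* The image passes below 0, that is, just below 1 around the circle. *)
    - have := UL Uimg; rewrite -(reachDz s al (D * u) 1) => Lcr.
      apply: (reach_noncrossing _ _ _ _ Lab Lcr); rewrite ?mulr1z; try lra; nra.
    - by apply: (reach_noncrossing _ _ _ _ Lab (UL Utu)); lra.
    - rewrite u_eq0 mulr0 mkchordC in Uimg.
      have := core_fix core Uimg k0 fixa; rewrite img => /reach_inj E.
      rewrite ga0 eqxx in t4.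
      have : D * (D * t) = D * t by apply: E; rewrite ltr_norml; lra.
      nra.
  rewrite (negPf ga0) in t4 u4.
  rewrite ltr0_norm ?subr_lt0// in t3 u3.
  by apply: (reach_noncrossing _ _ _ _ Limg (UL Utu)); lra.
rewrite gtr0_norm ?subr_gt0// in t3 u3.
by apply: (reach_noncrossing _ _ _ _ Lab (UL Uimg)); lra.
Qed.

(** A chord of [U] near [ab] cannot have its end near [a] on either side of [a], so
it ends at [a] and its other end is fixed; but the points near [b] are not
fixed when [b] is not. *)
Lemma limit_fix a b k : leaf L (mkchord a b) -> (0 < k)%N ->
  iter k (sigma d) a = a -> iter k (sigma d) b = b.
Proof.
move=> Lab k0 fixa; apply: contrapT => nfixb.
have ab : a <> b by move=> ab; case: Lab => _; apply; apply/degenerate_mk.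
set al := angle a; set be := turn a b.
have be01 : 0 < be < 1 by rewrite turn_gt0//; case/andP: (turn_itv a b).
have aE : a = proj al by rewrite angleK.
have bE : b = proj (al + be) by rewrite proj_turn.
have a0 s : reach s al 0 = a by rewrite /reach oppr0 if_same addr0 -aE.
have b1 : reach true al be = b by rewrite bE.
have b2 : reach false al (1 - be) = b.
  by rewrite /reach bE -[RHS]projB1; congr proj; ring.
have [| | | | |e1 e1_gt0 e1P] := @no_leaf_on_side true al be k => //.
- by rewrite a0 b1; case: Lab.
- by rewrite a0.
- by rewrite b1.
have [| | | | |e2 e2_gt0 e2P] := @no_leaf_on_side false al (1 - be) k => //.
- by lra.
- by rewrite a0 b2; case: Lab.
- by rewrite a0.
- by rewrite b2.
set D : R := d%:R ^+ k.
have D1 : 1 <= D by rewrite exprn_ege1.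
have [|e3 e3_gt0 e3P] := @int_gap (D * (al + be) - (al + be)).
  move=> n nE; apply: nfixb; rewrite bE iter_sigma_proj -/D.
  by apply/esym/proj_eqP; exists n; rewrite -nE; ring.
have e0 : 0 < Num.min e1 (Num.min e2 (e3 / D)).
  by rewrite !lt_min e1_gt0 e2_gt0 divr_gt0//; lra.
have := limit_dense (x := al) (y := al + be); rewrite -aE -bE.
have D0 : 0 < D by lra.
move=> /(_ _ Lab e0)[t [u []]]; rewrite !lt_min !(ltr_pdivlMr _ _ D0).
move=> /and3P[t1 t2 t3] /and3P[u1 u2 u3] Utu.
have [t_lt|t_gt|t_eq] := ltgtP t 0.
- apply: (e2P (- t) (- u)); rewrite ?normrN//.
    by rewrite oppr_gt0 t_lt/=; move: t2; rewrite ltr0_norm.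
  rewrite /reach opprK.
  have -> : al - (1 - be - u) = al + be + u - 1 by ring.
  by rewrite projB1.
- apply: (e1P t u) => //; last by rewrite /reach addrA.
  by rewrite t_gt/=; move: t1; rewrite gtr0_norm.
- rewrite t_eq addr0 -aE in Utu.
  have := core_fix core Utu k0 fixa; rewrite iter_sigma_proj -/D.
  move=> /esym/proj_eqP[n nE].
  apply: (e3P ((D - 1) * u) n); last by move: nE; nra.
  rewrite normrM ger0_norm; last lra.
  by have := normr_ge0 u; nra.
Qed.

Lemma limit_same_period a b : leaf L (mkchord a b) -> periodic_point d a ->
  exists k, has_period d a k /\ has_period d b k.
Proof.
move=> Lab [k0 k0_gt0 k0a].
have exk : exists k, (0 < k)%N && `[< iter k (sigma d) a = a >].
  by exists k0; rewrite k0_gt0; apply/asboolP.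
have [k /andP[k_gt0 /asboolP ka] kmin] := ex_minnP exk.
have amin j : (0 < j < k)%N -> iter j (sigma d) a <> a.
  move=> /andP[j0 jk] ja; have := kmin j; rewrite j0 leqNgt jk.
  by move/asboolP: ja => -> /(_ isT).
exists k; split; split => //; first exact: (limit_fix Lab k_gt0 ka).
move=> j jk jb; apply: (amin j jk); case/andP: jk => j0 _.
by apply: limit_fix jb => //; rewrite mkchordC.
Qed.

Lemma limit_periodic a b : leaf L (mkchord a b) -> periodic_point d a ->
  periodic_point d b.
Proof. by move=> Lab /(limit_same_period Lab)[k [_ [k0 kb _]]]; exists k. Qed.

Lemma limit_proper : proper_lamination d L.
Proof.
have endP l v : leaf L l -> is_end l v -> exists b, l = mkchord v b.
  move=> _ [->|->]; first by exists (end2 l); rewrite mkchord_ends.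
  by exists (end1 l); rewrite mkchordC mkchord_ends.
split=> [l v Ll cl lv pv|v l m [[Ll Lm] lm [lv mv] lmE _] pv].
  have [b lE] := endP _ _ Ll lv.
  have pb : periodic_point d b by apply: limit_periodic pv; rewrite -lE.
  have svb : sigma d v = sigma d b.
    by move: cl; rewrite /critical_chord lE; case: (end_mkchord v b) => -[-> ->].
  by case: Ll => _; apply; rewrite lE; apply/degenerate_mk; exact: periodic_sigma_inj svb.
have [b lE] := endP _ _ Ll lv; have [c mE] := endP _ _ Lm mv.
apply: lm; rewrite lE mE; congr mkchord.
move: lmE; rewrite lE mE !chord_map_mk => /mkchord_injr; apply: periodic_sigma_inj.
  by apply: limit_periodic pv; rewrite -lE.
by apply: limit_periodic pv; rewrite -mE.
Qed.

Let divd_small t e : `|t| < e -> `|t / d%:R| < e.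
Proof.
move=> te; apply: le_lt_trans te; rewrite normrM normfV (gtr0_norm dR_gt0).
by rewrite ler_pdivrMr// ler_peMr.
Qed.

(** The same pair of preimage indices serves for approximants of every precision. *)
Lemma limit_preimage l : L l -> exists2 m, L m & chord_map d m = l.
Proof.
move=> /limit_leaf_or_point[Ll|dl]; last first.
  have [x lE] : exists x, l = mkchord (proj x) (proj x).
    by exists (angle (end1 l)); rewrite angleK {2}dl mkchord_ends.
  pose c : circle R := proj ((x + (Ordinal d0)%:R) / d%:R).
  by exists (mkchord c c); [exact: limit_degenerate|rewrite chord_map_mk lE sigma_preimageK].
have [x [y lE]] := chordP l; rewrite lE in Ll *.
pose Q (ij : 'I_d * 'I_d) e := exists t u, [/\ `|t| < e, `|u| < e &
  L (mkchord (proj ((x + ij.1%:R) / d%:R + t)) (proj ((y + ij.2%:R) / d%:R + u)))].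
have [z e e' ee' [t [u [te ue Q1]]]|e e0|ij ijP] := @finite_choice_small _ Q.
- by exists t, u; split => //; [exact: lt_le_trans te ee'|exact: lt_le_trans ue ee'].
- have [t [u [te ue Utu]]] := limit_dense Ll e0.
  have [m Um /(chord_preimage d0)[i [j mE]]] := core_preimage core Utu.
  exists (i, j), (t / d%:R), (u / d%:R); split; [exact: divd_small..|].
  by rewrite -!mulrDl (addrAC x) (addrAC y) -mE; exact: UL.
exists (mkchord (proj ((x + ij.1%:R) / d%:R)) (proj ((y + ij.2%:R) / d%:R))).
  exact: limit_closed.
by rewrite chord_map_mk !sigma_preimageK.
Qed.

(** Sibling families of approximants are given by pairs of bijections of ['I_d] and a
common perturbation of the ends.  For a pair of bijections that works at every
precision, the limit chords have distinct ends, so noncrossing makes them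
disjoint. *)
Lemma limit_siblings l : L l -> ~ degenerate (chord_map d l) -> has_siblings d L l.
Proof.
move=> Ll nl; have [x0 [y0 lE]] := chordP l.
have {}Ll : leaf L (mkchord (proj x0) (proj y0)).
  rewrite -lE; split => // dl; apply: nl.
  by rewrite /chord_map dl; apply/degenerate_mk.
set x := d%:R * x0; set y := d%:R * y0; pose z0 := Ordinal d0.
have lmE : chord_map d l = mkchord (proj x) (proj y) by rewrite lE chord_map_mk !sigma_proj.
have nxy : proj x <> proj y by move=> xy; apply: nl; rewrite lmE; apply/degenerate_mk.
have xDE t (i : 'I_d) : (d%:R * (x0 + t) + i%:R) / d%:R = (x + i%:R) / d%:R + t.
  by rewrite /x; field; rewrite gt_eqF.
have yDE t (i : 'I_d) : (d%:R * (y0 + t) + i%:R) / d%:R = (y + i%:R) / d%:R + t.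
  by rewrite /y; field; rewrite gt_eqF.
pose Q (pq : {ffun 'I_d -> 'I_d} * {ffun 'I_d -> 'I_d}) e :=
  [/\ injective pq.1, injective pq.2, exists i, pq.1 i = z0 /\ pq.2 i = z0 &
   exists t u, [/\ `|t| < e, `|u| < e & forall i,
     L (mkchord (proj ((x + (pq.1 i)%:R) / d%:R + t))
                (proj ((y + (pq.2 i)%:R) / d%:R + u)))]].
have [z e e' ee' [pinj qinj i0 [t [u [te ue Q1]]]]|e e0|[p q] pqP] :=
    @finite_choice_small _ Q.
- split => //; exists t, u; split => //; first exact: lt_le_trans te ee'.
  exact: lt_le_trans ue ee'.
- have [t [u [te ue Utu]]] := limit_dense Ll e0.
  have [f [[i0 fi0] fU fdisj]] := core_siblings core Utu.
  have imE : chord_map d (mkchord (proj (x0 + t)) (proj (y0 + u))) =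
      mkchord (proj (d%:R * (x0 + t))) (proj (d%:R * (y0 + u))).
    by rewrite chord_map_mk !sigma_proj.
  have fE i : chord_map d (f i) =
      mkchord (proj (d%:R * (x0 + t))) (proj (d%:R * (y0 + u))).
    by rewrite (fU i).2.
  have nd : proj (d%:R * (x0 + t)) <> proj (d%:R * (y0 + u)).
    move=> E; apply: (core_nondegenerate core (core_forward core Utu)).
    by rewrite imE; apply/degenerate_mk.
  have [p [q [pinj qinj pqE]]] := sibling_matching d0 fE fdisj.
  exists ([ffun i => p i], [ffun i => q i]); split => /=.
  + by move=> i j; rewrite !ffunE => /pinj.
  + by move=> i j; rewrite !ffunE => /qinj.
  + exists i0; rewrite !ffunE; move: fi0; rewrite pqE.
    move=> /mkchord_inj[[pE qE]|[/(congr1 (sigma d)) E _]]; last first.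
      by case: nd; move: E; rewrite sigma_preimageK sigma_proj.
    have dK (r : R) : (d%:R * r + 0) / d%:R = r by field; rewrite gt_eqF.
    split.
      by apply: (@preimage_inj R d (d%:R * (x0 + t))); rewrite pE /= dK.
    by apply: (@preimage_inj R d (d%:R * (y0 + u))); rewrite qE /= dK.
  + exists t, u; split => // i; rewrite !ffunE -xDE -yDE -pqE.
    by apply: UL; exact: (fU i).1.
have [pinj qinj [i0 [pi0 qi0]] _] := pqP 1 ltr01.
have LF i : L (mkchord (proj ((x + (p i)%:R) / d%:R)) (proj ((y + (q i)%:R) / d%:R))).
  apply: limit_closed => e e0; have [_ _ _ [t [u [te ue H]]]] := pqP e e0.
  by exists t, u.
exists (fun i => mkchord (proj ((x + (p i)%:R) / d%:R)) (proj ((y + (q i)%:R) / d%:R))).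
split.
- exists i0; rewrite pi0 qi0 lE !addr0 /x /y.
  by rewrite ![d%:R * _]mulrC !mulfK// gt_eqF.
- move=> i; split; last by rewrite lmE chord_map_mk !sigma_preimageK.
  split => // /degenerate_mk /(congr1 (sigma d)).
  by rewrite !sigma_preimageK.
- move=> i j ij; apply: (disjoint_chordsP lamL) => // v.
  move=> /is_end_mk[->|->] /is_end_mk[].
  + by move/preimage_inj/pinj.
  + by move/(congr1 (sigma d)); rewrite !sigma_preimageK.
  + by move/(congr1 (sigma d)); rewrite !sigma_preimageK => /esym.
  + by move/preimage_inj/qinj.
Qed.

Lemma limit_sibling_invariant : sibling_invariant d L.
Proof.
split; [|exact: limit_preimage|exact: limit_siblings].
by move=> l Ll; left; exact: limit_forward.
Qed.

End Limit.

(** * Limits of sequences to the end *)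

Section SequenceLimit.
Context {R : realType}.
Variables (d : nat) (P L : set (chord R)) (Ls : nat -> set (chord R)).
Hypothesis Ls_seq : sequence_to_end d P Ls.
Hypothesis lamL : lamination L.
Hypothesis cvgL : hausdorff_dist (Ls n) L @[n --> \oo] --> (0 : R).

Definition seq_leaves : set (chord R) := [set l | exists n, leaf (Ls n) l].

Lemma seq_invariant_core : (2 <= d)%N -> invariant_core d seq_leaves.
Proof.
move=> d2; split.
- by move=> l [n []].
- by move=> l [n Ll]; exists n; exact: leaf_chord_map (seq_FDL Ls_seq n) Ll.
- move=> l [n /(seq_leaf_preimage Ls_seq)[m Lm mE]].
  by exists m => //; exists n.+1.
- move=> l [n /(seq_siblings Ls_seq d2)[k [f [fl fL fdisj]]]].
  exists f; split => // i; split; last exact: (fL i).2.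
  by exists k; exact: (fL i).1.
- by move=> a b k [n Lab]; exact: (seq_fix Ls_seq d2 Lab).
Qed.

Lemma seq_hausdorff_small (e : R) : 0 < e ->
  exists N, forall n, (N <= n)%N -> hausdorff_dist (Ls n) L < e.
Proof. by move=> e0; have [N _ HN] := cvgr_lt _ cvgL _ e0; exists N => n /HN. Qed.

Lemma seq_sub_limit : seq_leaves `<=` L.
Proof.
move=> l [n [Ll _]]; case: (lamL) => Lcl _ Ldeg; apply: Lcl => e /seq_hausdorff_small[N HN].
have Lne : L !=set0.
  by exists (mkchord (end1 l) (end1 l)); apply: Ldeg; apply/degenerate_mk.
apply: (hausdorff_dist_lt Lne (HN _ (leq_maxl N n))).
exact: (seq_sub Ls_seq (leq_maxr N n)).
Qed.

Lemma seq_dense l (e : R) : leaf L l -> 0 < e ->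
  exists2 m, seq_leaves m & chord_dist l m < e.
Proof.
move=> [Ll nl] e0; have [x [y lE]] := chordP l.
have [n xyn|g g0 gP] := @int_gap R (y - x).
  apply: nl; rewrite lE; apply/degenerate_mk/proj_eqP; exists n; lra.
have e'0 : 0 < Num.min e (g / 2) by rewrite lt_min e0 divr_gt0.
have [N HN] := seq_hausdorff_small e'0.
have Lne : Ls N !=set0 by have [m []] := fdl_nonempty (seq_FDL Ls_seq N); exists m.
have := HN N (leqnn N); rewrite hausdorff_distC => /(hausdorff_dist_lt Lne)/(_ _ Ll).
move=> [m Lm lm]; have me : chord_dist l m < e by move: lm; rewrite lt_min => /andP[].
exists m => //; exists N; split => //.
move: lm; rewrite lE => /chord_dist_lt[t [u [te ue ->]]].
move=> /degenerate_mk/proj_eqP[n nE]; apply: (gP (u - t) n); last lra.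
apply: (le_lt_trans (ler_normB _ _)).
by move: te ue; rewrite !lt_min => /andP[_ te] /andP[_ ue]; lra.
Qed.

End SequenceLimit.

Theorem theorem5p12 (R : realType) (d : nat) (P L : set (chord R)) :
  (2 <= d)%N -> constitutes_FDL d P -> base d P L ->
  (forall a b : circle R, leaf L (mkchord a b) -> periodic_point d a ->
     exists k : nat, has_period d a k /\ has_period d b k) /\
  proper_lamination d L /\ sibling_invariant d L.
Proof.
move=> d2 _ [lamL [Ls Ls_seq cvgL]].
have core := seq_invariant_core Ls_seq d2.
have UL := seq_sub_limit Ls_seq lamL cvgL.
have dense := seq_dense Ls_seq cvgL.
split; last split.
- by move=> a b; exact: (limit_same_period d2 core lamL UL dense).
- exact: (limit_proper d2 core lamL UL dense).
- exact: (limit_sibling_invariant d2 core lamL UL dense).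
Qed.
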